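(* Let $n\ge 3$ be an integer, and let $\Phi$ be a smooth real-valued function on the closed unit ball $\overline{\mathbb{B}^n}$ that is even with respect to $x_1$, i.e. $\Phi(-x_1,x')=\Phi(x_1,x')$ for all $x=(x_1,x')\in\overline{\mathbb{B}^n}\subset\mathbb{R}\times\mathbb{R}^{n-1}$. Suppose that $$\mathcal{A}_\Phi>0\ \text{ on }\overline{\mathbb{B}^n},\qquad q_\Phi>0\ \text{ on }\mathbb{S}^{n-1},\qquad \mathcal{L}_n(\Phi)<0. \quad ( * )$$ Then there exists $t_0>0$ such that, for every $0<t<t_0$, the conformal metric $g_t=e^{2t\Phi}\delta$ on $\overline{\mathbb{B}^n}$ satisfies $$\mathrm{Ric}_{g_t}>0,\qquad \mathrm{II}_{g_t}>g_t|_{\partial\mathbb{B}^n},\qquad \sigma_1(\mathbb{B}^n,g_t)<1.$$ Moreover, the set of smooth functions on $\overline{\mathbb{B}^n}$ that are even with respect to $x_1$ and satisfy the three conditions $( * )$ is open, in the $C^2$ topology, in the space of smooth functions on $\overline{\mathbb{B}^n}$ that are even with respect to $x_1$. (Thus each such $\Phi$ yields an infinite-dimensional open family of functions whose associated metrics $g_t$, for small $t>0$, have the three properties above.)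
   Context: $\mathbb{B}^n\subset\mathbb{R}^n$ is the open unit ball, $\mathbb{S}^{n-1}=\partial\mathbb{B}^n$, $\omega_n=|\mathbb{B}^n|$ is its volume, $\delta=g_{\mathbb{R}^n}$ is the Euclidean metric, and $\nu$ denotes the outward unit normal. For a smooth function $\Phi$ on $\overline{\mathbb{B}^n}$ define, with Euclidean Hessian, Laplacian ($\Delta=\sum_i\partial_i^2$) and normal derivative, $$\mathcal{A}_\Phi:=-(n-2)\,\mathrm{Hess}\,\Phi-(\Delta\Phi)\,\delta,\qquad q_\Phi:=\partial_\nu\Phi-\Phi \ \text{ on }\mathbb{S}^{n-1},$$ $$\mathcal{L}_n(\Phi):=\frac1{\omega_n}\left((n-2)\int_{\mathbb{B}^n}\Phi\,dx-(n-1)\int_{\mathbb{S}^{n-1}}x_1^2\,\Phi\,dS\right).$$ Inequalities between symmetric 2-tensors are in the sense of quadratic forms at each point ($\mathcal{A}_\Phi>0$ means positive definite at each point). For a compact Riemannian manifold $(M,g)$ with boundary $\Sigma$ and outward unit normal $\nu$, the second fundamental form is $\mathrm{II}_g(X,Y)=g(\nabla_X\nu,Y)$ for $X,Y\in T\Sigma$ (so the Euclidean unit sphere, as boundary of the unit ball, has principal curvatures $+1$). The first nonzero Steklov eigenvalue (for $\Delta_g u=0$ in $M$, $\partial_\nu u=\sigma u$ on $\Sigma$) is $$\sigma_1(M,g)=\inf\left\{\frac{\int_M|\nabla_g u|_g^2\,dV_g}{\int_\Sigma u^2\,dS_g}\ :\ u\in H^1(M)\setminus\{0\},\ \int_\Sigma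 u\,dS_g=0\right\}.$$ *)

(* Defs.v *)
From HB Require Import structures.
Set Warnings "-all".
From mathcomp Require Import all_boot all_order all_algebra.
From mathcomp Require Import all_classical all_reals all_analysis.

Set Implicit Arguments.
Unset Strict Implicit.
Unset Printing Implicit Defensive.
Import Order.TTheory GRing.Theory Num.Theory.
Import numFieldNormedType.Exports.

Local Open Scope classical_set_scope.
Local Open Scope ring_scope.

(* Lebesgue measure on R^n.  'rV[R]_n carries the sigma-algebra generated by
   the coordinates (the Borel one), as the library does for n.-tuple R. *)

Definition measure_rV_display : measure_display.
Proof. exact: default_measure_display. Qed.

Section rV_measurable.
Variables (R : realType) (n : nat).

Let coors : 'I_n -> 'rV[R]_n -> R := fun i x => x ord0 i.

Let rV_set0 : g_sigma_preimage coors set0.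
Proof. exact: sigma_algebra0. Qed.

Let rV_setC A : g_sigma_preimage coors A -> g_sigma_preimage coors (~` A).
Proof. exact: sigma_algebraC. Qed.

Let rV_bigcup (F : (set 'rV[R]_n)^nat) :
  (forall i, g_sigma_preimage coors (F i)) ->
  g_sigma_preimage coors (\bigcup_i F i).
Proof. exact: sigma_algebra_bigcup. Qed.

HB.instance Definition _ := @isMeasurable.Build measure_rV_display
  'rV[R]_n (g_sigma_preimage coors) rV_set0 rV_setC rV_bigcup.

Lemma measurable_coord (i : 'I_n) :
  measurable_fun [set: 'rV[R]_n] (fun x : 'rV[R]_n => x ord0 i).
Proof.
move=> _ Y mY; rewrite setTI; apply: sub_sigma_algebra => /=.
rewrite -bigcup_seq/=; exists i => /=; first by rewrite mem_index_enum.
by exists Y => //; rewrite setTI.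
Qed.

Lemma measurable_fun_coordP d (T : measurableType d) (f : T -> 'rV[R]_n) :
  (forall i, measurable_fun [set: T] (fun t => f t ord0 i)) ->
  measurable_fun [set: T] f.
Proof.
move=> mf _ Y; apply: (@smallest_sub _ (@sigma_algebra _ setT)
  _ [set Y | measurable ([set: T] `&` f @^-1` Y)]).
  split => //=.
  - by rewrite preimage_set0 setI0.
  - move=> A mA; rewrite setTD setTI preimage_setC; apply: measurableC.
    by rewrite -[X in measurable X]setTI.
  - move=> F mF; rewrite setTI preimage_bigcup; apply: bigcupT_measurable => k.
    by rewrite -[X in measurable X]setTI; exact: mF.
move=> A; rewrite -bigcup_seq => -[i _ [B mB <-]] /=.
by rewrite [X in _ @^-1` X]setTI -comp_preimage; exact: mf.
Qed.

End rV_measurable.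

Section rV_lebesgue.
Variable R : realType.

Definition rV_cons n (p : R * 'rV[R]_n) : 'rV[R]_n.+1 := row_mx p.1%:M p.2.

Lemma measurable_rV_cons n :
  measurable_fun [set: R * 'rV[R]_n] (@rV_cons n).
Proof.
apply: measurable_fun_coordP => i.
rewrite (_ : (fun _ => _) = fun t : R * 'rV[R]_n => match @fintype.split 1 n i with
  inl _ => t.1 | inr j => t.2 ord0 j end); last first.
  apply/funext => t; rewrite /rV_cons mxE; case: fintype.split => // j.
  by rewrite (ord1 j) mxE eqxx mulr1n.
case: fintype.split => j; first exact: measurable_fst.
exact: (measurableT_comp (@measurable_coord R n j) measurable_snd).
Qed.

Section step.
Variables (n : nat) (m : {sigma_finite_measure set 'rV[R]_n -> \bar R}).

Definition lebesgue_cons : set 'rV[R]_n.+1 -> \bar R :=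
  pushforward ((@lebesgue_measure R) \x m)%E (@rV_cons n).

Let preim A : measurable A -> measurable (@rV_cons n @^-1` A).
Proof. by move=> mA; rewrite -[X in measurable X]setTI; exact: measurable_rV_cons. Qed.

Let lebesgue_cons0 : lebesgue_cons set0 = 0%E.
Proof. by rewrite /lebesgue_cons /pushforward preimage_set0 measure0. Qed.

Let lebesgue_cons_ge0 A : (0 <= lebesgue_cons A)%E.
Proof. by rewrite /lebesgue_cons /pushforward; exact: measure_ge0. Qed.

Let lebesgue_cons_sigma_additive : semi_sigma_additive lebesgue_cons.
Proof.
move=> F mF tF mUF; rewrite /lebesgue_cons /pushforward preimage_bigcup.
apply: measure_semi_sigma_additive.
- by move=> k; exact: preim.
- apply/trivIsetP => /= i j _ _ ij; rewrite -preimage_setI.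
  by move/trivIsetP : tF => /(_ _ _ _ _ ij) ->//; rewrite preimage_set0.
- by rewrite -preimage_bigcup; exact: preim.
Qed.

HB.instance Definition _ := isMeasure.Build _ _ _ lebesgue_cons
  lebesgue_cons0 lebesgue_cons_ge0 lebesgue_cons_sigma_additive.

Let lebesgue_cons_sigma_finite : sigma_finite setT lebesgue_cons.
Proof.
have /sigma_finiteP[F [FT ndF Foo]] := sigma_finiteT (@lebesgue_measure R).
have /sigma_finiteP[G [GT ndG Goo]] := sigma_finiteT m.
pose h (x : 'rV[R]_n.+1) : R * 'rV[R]_n :=
  (x ord0 ord0, \row_j x ord0 (lift ord0 j)).
have mh : measurable_fun setT h.
  apply/measurable_fun_pairP; split => /=; first exact: measurable_coord.
  apply: measurable_fun_coordP => i /=.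
  rewrite (_ : (fun _ => _) = fun x : 'rV[R]_n.+1 => x ord0 (lift ord0 i)).
    exact: measurable_coord.
  by apply/funext => x /=; rewrite mxE.
have hK p : h (rV_cons p) = p.
  case: p => a y; rewrite /h /rV_cons /=; congr pair.
    by rewrite mxE; case: splitP => // j _; rewrite (ord1 j) mxE eqxx mulr1n.
  apply/rowP => j; rewrite !mxE; case: splitP => [i /= | i /eqP /=].
    by rewrite (ord1 i) /bump leq0n.
  by rewrite /bump leq0n eqn_add2l => /eqP /val_inj ->.
exists (fun k => h @^-1` (F k `*` G k)).
  apply/seteqP; split => // x _.
  have [i _ Fi] : (\bigcup_k F k) (h x).1 by rewrite -FT.
  have [j _ Gj] : (\bigcup_k G k) (h x).2 by rewrite -GT.
  exists (maxn i j) => //; split.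
  - by move: (h x).1 Fi; exact/subsetPset/ndF/leq_maxl.
  - by move: (h x).2 Gj; exact/subsetPset/ndG/leq_maxr.
move=> k; have [mFk Fk] := Foo k; have [mGk Gk] := Goo k; split.
  by rewrite -[X in measurable X]setTI; apply: mh => //; exact: measurableX.
rewrite /lebesgue_cons /pushforward -comp_preimage.
rewrite (_ : h \o _ = id); last exact/funext.
by rewrite preimage_id product_measure1E// lte_mul_pinfty// ge0_fin_numE.
Qed.

HB.instance Definition _ := Measure_isSigmaFinite.Build _ _ _ lebesgue_cons
  lebesgue_cons_sigma_finite.

End step.

Fixpoint lebesgue_rV n : {sigma_finite_measure set 'rV[R]_n -> \bar R} :=
  match n with
  | 0 => dirac (0 : 'rV[R]_0)
  | n'.+1 => lebesgue_cons (lebesgue_rV n')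
  end.

End rV_lebesgue.

Section calculus.
Variables (R : realType) (n : nat).
Implicit Types (f : 'rV[R]_n -> R) (x : 'rV[R]_n) (s : seq 'I_n).

(* The library norm on 'rV[R]_n is the sup norm; balls and spheres below are
   Euclidean, while openness and differentiability do not depend on the norm. *)
Definition sqnorm x : R := \sum_i x ord0 i ^+ 2.
Definition oball : set 'rV[R]_n := [set x | sqnorm x < 1].
Definition cball : set 'rV[R]_n := [set x | sqnorm x <= 1].
Definition sphere : set 'rV[R]_n := [set x | sqnorm x = 1].

Definition partial (i : 'I_n) f : 'rV[R]_n -> R := fun x => 'D_(delta_mx ord0 i) f x.
Definition partials s f : 'rV[R]_n -> R := foldr partial f s.

(* A function on the closed ball is represented by a function on R^n.  It is
   smooth when it is C^oo on a neighbourhood of the closed ball; its partial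
   derivatives on the closed ball then depend on its values there only. *)
Definition smooth_cball f : Prop :=
  exists U : set 'rV[R]_n, [/\ open U, cball `<=` U &
    forall s x, U x -> differentiable (partials s f) x].

Definition hess f x : 'M[R]_n := \matrix_(i, j) partial i (partial j f) x.
Definition laplacian f x : R := \sum_i partial i (partial i f) x.
Definition differential f x : 'rV[R]_n := \row_i partial i f x.

Definition posdef (A : 'M[R]_n) : Prop :=
  forall v : 'rV[R]_n, v != 0 -> 0 < (v *m A *m v^T) ord0 ord0.

Definition A_tensor f x : 'M[R]_n :=
  - (n%:R - 2) *: hess f x - (laplacian f x)%:M.

(* On the unit sphere the outward Euclidean unit normal at x is x itself. *)
Definition q_bdry f x : R := 'D_x f x - f x.

Definition C2_norm f : \bar R :=
  ereal_sup [set q | exists s x,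
    [/\ (size s <= 2)%N, cball x & q = `|partials s f x|%:E]].

(* S is open in X for the C^2 topology *)
Definition C2_open_in (X S : set ('rV[R]_n -> R)) : Prop :=
  S `<=` X /\ forall f, S f -> exists2 e : R, 0 < e &
    forall h, X h -> (C2_norm (fun x => (h x - f x)%R) < e%:E)%E -> S h.

(* As functions on the closed ball, the elements of S lie in no
   finite-dimensional space of functions. *)
Definition infinite_dimensional (S : set ('rV[R]_n -> R)) : Prop :=
  forall (N : nat) (e : 'I_N -> 'rV[R]_n -> R), exists2 f, S f &
    forall c : 'I_N -> R, exists2 x, cball x & f x <> \sum_i c i * e i x.

End calculus.
Arguments oball {R} n.
Arguments cball {R} n.
Arguments sphere {R} n.

(* A Riemannian metric on the closed ball is given by its matrix
   (g_ij) in Cartesian coordinates. *)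
Section riemannian.
Variables (R : realType) (n : nat).
Variable g : 'rV[R]_n -> 'M[R]_n.
Implicit Types (x X Y : 'rV[R]_n) (i j k : 'I_n).

Definition christoffel k i j x : R :=
  2^-1 * \sum_l invmx (g x) k l *
    (partial i (fun y => g y j l) x + partial j (fun y => g y i l) x
     - partial l (fun y => g y i j) x).

Definition ricci x : 'M[R]_n := \matrix_(i, j) \sum_k
  (partial k (christoffel k i j) x - partial j (christoffel k i k) x
   + \sum_l (christoffel k k l x * christoffel l i j x
             - christoffel k j l x * christoffel l i k x)).

Definition gdot x X Y : R := (X *m g x *m Y^T) ord0 ord0.

(* squared norm of a covector *)
Definition cosqnorm x (xi : 'rV[R]_n) : R :=
  (xi *m invmx (g x) *m xi^T) ord0 ord0.

(* Normalized g-gradient of |x|^2/2: on the unit sphere, this is the outward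
   g-unit normal field. *)
Definition normal x : 'rV[R]_n :=
  (Num.sqrt (cosqnorm x x))^-1 *: (x *m invmx (g x)).

Definition cov_deriv (X : 'rV[R]_n) (V : 'rV[R]_n -> 'rV[R]_n) x : 'rV[R]_n :=
  'D_X V x + \row_k \sum_i \sum_j christoffel k i j x * X ord0 i * V x ord0 j.

Definition second_form x X Y : R := gdot x (cov_deriv X normal x) Y.

Definition vol_integral (f : 'rV[R]_n -> R) : \bar R :=
  \int[lebesgue_rV R n]_(x in oball n) (f x * Num.sqrt (\det (g x)))%:E.

End riemannian.

Definition euclidean (R : realType) (n : nat) : 'rV[R]_n -> 'M[R]_n := fun=> 1%:M.

Definition conformal (R : realType) (n : nat) (t : R) (Phi : 'rV[R]_n -> R) :
  'rV[R]_n -> 'M[R]_n := fun x => expR (2 * t * Phi x) *: euclidean x.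

(* From now on the dimension of the ball is n = d.+1; the first coordinate x_1
   is x ord0 ord0. *)
Section ball_boundary.
Variables (R : realType) (d : nat).
Implicit Types (f u w : 'rV[R]_d.+1 -> R) (g : 'rV[R]_d.+1 -> 'M[R]_d.+1).

(* The sphere, up to its null equator {x_1 = 0}, is covered by the two charts
   y |-> (+/- sqrt (1 - |y|^2), y), for y in the open unit ball of R^d; the
   Riemannian measure in a chart is sqrt (det h) dy, where h is the pulled-back
   metric. *)
Definition hemisphere (b : bool) (y : 'rV[R]_d) : 'rV[R]_d.+1 :=
  rV_cons ((-1) ^+ b * Num.sqrt (1 - sqnorm y), y).

Definition pullback_metric g (b : bool) (y : 'rV[R]_d) : 'M[R]_d :=
  let J := jacobian (hemisphere b) y in J *m g (hemisphere b y) *m J^T.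

Definition surf_integral g f : \bar R :=
  (\sum_(b : bool) \int[lebesgue_rV R d]_(y in oball d)
    (f (hemisphere b y) * Num.sqrt (\det (pullback_metric g b y)))%:E)%E.

(* u is in H^1, with weak differential du and boundary trace w.  Here H^1 is the
   completion of the smooth functions on the closed ball for the H^1 norm, and
   the trace is the continuous extension to H^1 of the restriction to the
   boundary. *)
Definition H1_with_trace g u (du : 'rV[R]_d.+1 -> 'rV[R]_d.+1) w : Prop :=
  [/\ measurable_fun (oball d.+1) u, measurable_fun (oball d.+1) du,
      measurable_fun (sphere d.+1) w &
    exists v : nat -> 'rV[R]_d.+1 -> R,
    [/\ forall k, smooth_cball (v k),
        vol_integral g (fun x => (v k x - u x) ^+ 2) @[k --> \oo] --> 0%E,
        vol_integral g (fun x => cosqnorm g x (differential (v k) x - du x))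
          @[k --> \oo] --> 0%E &
        surf_integral g (fun x => (v k x - w x) ^+ 2) @[k --> \oo] --> 0%E]].

(* In \bar R, 0^-1 = +oo: functions of zero trace contribute +oo.  Numerator and
   denominator do not both vanish, since a nonzero function with du = 0 is
   constant. *)
Definition steklov1 g : \bar R :=
  ereal_inf [set q | exists u du w, [/\ H1_with_trace g u du w,
    vol_integral g (fun x => u x ^+ 2) != 0%E,
    surf_integral g w = 0%E &
    q = (vol_integral g (fun x => cosqnorm g x (du x))
         / surf_integral g (fun x => (w x ^+ 2)%R))%E]].

Definition ball_volume : R := fine (lebesgue_rV R d.+1 (oball d.+1)).

Definition L_functional f : R :=
  ball_volume^-1 *
  ((d.+1%:R - 2) * fine (vol_integral (@euclidean R d.+1) f)
   - (d.+1%:R - 1) *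
     fine (surf_integral (@euclidean R d.+1) (fun x => x ord0 ord0 ^+ 2 * f x))).

Definition reflect1 (x : 'rV[R]_d.+1) : 'rV[R]_d.+1 :=
  \row_i (if i == ord0 then - x ord0 i else x ord0 i).

Definition even_smooth : set ('rV[R]_d.+1 -> R) :=
  [set f | smooth_cball f /\ forall x, cball d.+1 x -> f (reflect1 x) = f x].

Definition admissible : set ('rV[R]_d.+1 -> R) :=
  [set f | [/\ even_smooth f,
    forall x, cball d.+1 x -> posdef (A_tensor f x),
    forall x, sphere d.+1 x -> 0 < q_bdry f x &
    L_functional f < 0]].

Definition ricci_positive g : Prop :=
  forall x, cball d.+1 x -> posdef (ricci g x).

(* II_g > g on the tangent spaces of the sphere *)
Definition second_form_gt_metric g : Prop :=
  forall x X, sphere d.+1 x -> X *m x^T = 0 -> X != 0 ->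
    gdot g x X X < second_form g x X X.

Definition small_steklov_for_small_time f : Prop :=
  exists2 t0 : R, 0 < t0 & forall t : R, 0 < t < t0 ->
    [/\ ricci_positive (conformal t f),
        second_form_gt_metric (conformal t f) &
        (steklov1 (conformal t f) < 1)%E].

End ball_boundary.

(* Main.v *)
Require Import Defs.
Set Warnings "-all".
From mathcomp Require Import all_boot all_order all_algebra.
From mathcomp Require Import all_classical all_reals all_analysis.
From mathcomp Require Import measurable_realfun ring lra.
Import Order.TTheory GRing.Theory Num.Theory.
Import numFieldNormedType.Exports.
Local Open Scope classical_set_scope.
Local Open Scope ring_scope.

Set Implicit Arguments.
Unset Strict Implicit.
Unset Printing Implicit Defensive.

(* For [g = e^(2 t Phi) delta] the conformal change formulas read
   [Ric_g = t A_Phi + (n - 2) t^2 (dPhi (x) dPhi - |dPhi|^2 delta)] and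
   [II_g = e^(t Phi) (1 + t d_nu Phi) delta] on the sphere; compactness of the
   ball turns the positivity of [A_Phi] and [q_Phi] into uniform bounds that
   absorb the terms of order [t^2].  The function [x_1] has zero mean on the
   boundary because [Phi] is even, and its Rayleigh quotient is
   [int_B e^((n-2) t Phi) / int_S x_1^2 e^((n-1) t Phi)].  Both integrals equal
   [omega_n] at [t = 0], and the derivative at [0] of numerator minus
   denominator is [omega_n L_n(Phi) < 0].  Adding small multiples of even
   powers of [x_1] to [Phi] shows that the admissible functions span an
   infinite-dimensional space. *)

(** * Smooth functions near the closed ball *)

(** Nothing is differentiated in [t]. In the Rayleigh quotient, [1 + z <= e^z] bounds the
    denominator from below and [e^z <= 1 + z + 2 z^2], for [|z| <= 1/2], bounds the numerator from
    above, so only integrals of [Phi] and of constants remain. The obstacle is the surface integral: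
    it lives in two graph charts whose density [1 / height] is unbounded near the equator. It is
    only evaluated on integrands carrying a factor [x_1] or [x_1^2], and [x_1 = +- height] in the
    charts, so the factor cancels the singularity and leaves a bounded integrand. Slicing the ball
    along [x_1] gives chords of length [2 height]. Hence the volume of the ball and the integral of
    [x_1^2] over the sphere are the same integral, and the volume is finite by induction on the
    dimension. That the volume is nonzero is read off from [L_functional Phi < 0], because
    [0^-1 = 0]. *)

Lemma near_eq_differentiable (R : numFieldType) (V W : normedModType R)
    (f g : V -> W) (x : V) :
  {near x, f =1 g} -> differentiable f x -> differentiable g x.
Proof.
move=> fg df; have fgx : f x = g x := nbhs_singleton fg.
have fg0 : \forall h \near nbhs (0 : V), f (h + x) = g (h + x).
  by move: fg; rewrite (near_shift (0 : V) x) subr0.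
have dg : g \o shift x = cst (g x) + 'd f x +o_ 0 id.
  apply/eqaddoP => e e0; move/diff_locally/eqaddoP : df => /(_ e e0) fo.
  near=> h; rewrite !fctE /= -fgx.
  have <- : f (h + x) = g (h + x) by near: h.
  by near: h.
have dcont := diff_continuous df.
by apply/diff_locallyP; rewrite (diff_unique dcont dg).
Unshelve. all: by end_near. Qed.

Section calculus.
Context {R : realType} {n : nat}.
Implicit Types (f g : 'rV[R]_n -> R) (x v : 'rV[R]_n) (U : set 'rV[R]_n).

(** The body of [smooth_cball] with its open set made explicit, so that several functions can share
    it and identities valid on it can be differentiated. *)
Definition smooth_on U f := forall s x, U x -> differentiable (partials s f) x.

Lemma smooth_onS U V f : V `<=` U -> smooth_on U f -> smooth_on V f.
Proof. by move=> VU sf s x /VU; exact: sf. Qed.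

Lemma is_derive_comp f (h : R -> R) x v (dh : R) :
  differentiable f x -> is_derive (f x) 1 h dh ->
  is_derive x v (h \o f) (dh * 'D_v f x).
Proof.
move=> df [dh1 hE]; have /derivable1_diffP dfh := dh1.
have dhf : differentiable (h \o f) x by exact: differentiable_comp.
apply: DeriveDef; first exact: diff_derivable.
rewrite deriveE// diff_comp//=.
by rewrite deriv1E//= derive1E hE deriveE// mulrC.
Qed.

Lemma is_derive_coord x v k : is_derive x v (fun y : 'rV[R]_n => y ord0 k) (v ord0 k).
Proof.
have d : differentiable (fun y : 'rV[R]_n => y ord0 k : R) x.
  exact: differentiable_coord.
apply: DeriveDef; first exact: diff_derivable.
by have := derive_mx (@derivable_id R _ x v); rewrite derive_id => {2}->; rewrite mxE.
Qed.

Lemma differentiable_sqnorm x : differentiable (@sqnorm R n) x.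
Proof.
rewrite (_ : @sqnorm R n = \sum_i (fun x => x ord0 i ^+ 2)); last first.
  by apply/funext => y; rewrite fct_sumE.
apply: differentiable_sum => i.
exact: (differentiableX 1 (differentiable_coord x ord0 i)).
Qed.

Lemma derive_partial f x v : differentiable f x ->
  'D_v f x = \sum_i v ord0 i * partial i f x.
Proof.
move=> df; rewrite deriveE// {1}(row_sum_delta v) linear_sum; apply: eq_bigr => i _.
by rewrite linearZ/= /partial deriveE.
Qed.

(** The induction on [s] differentiates the identity of the previous order, which must therefore
    hold near [x] and not only at [x]: this is where [open U] enters. *)
Lemma partials_lin U f g a : open U -> smooth_on U f -> smooth_on U g ->
  forall s x, U x ->
    partials s (fun y => f y + a * g y) x = partials s f x + a * partials s g x.
Proof.
move=> oU sf sg; elim=> [//|i s IH] x Ux /=.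
rewrite {1}/partial (near_eq_derive (g := partials s f + a \*: partials s g)).
  have d1 : derivable (partials s f) x (delta_mx ord0 i).
    by apply: diff_derivable; exact: sf.
  have d2 : derivable (partials s g) x (delta_mx ord0 i).
    by apply: diff_derivable; exact: sg.
  by rewrite deriveD ?deriveZ//; exact: derivableZ.
by near=> y; apply: IH; near: y; exact: open_nbhs_nbhs.
Unshelve. all: by end_near. Qed.


Lemma smooth_on_lin U f g a : open U -> smooth_on U f -> smooth_on U g ->
  smooth_on U (fun y => f y + a * g y).
Proof.
move=> oU sf sg s x Ux.
apply: (@near_eq_differentiable _ _ _ (partials s f + a \*: partials s g)).
  near=> y; rewrite (partials_lin a oU sf sg)//.
  by near: y; exact: open_nbhs_nbhs.
by apply: differentiableD; [exact: sf | apply: differentiableZ; exact: sg].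
Unshelve. all: by end_near. Qed.

Lemma smooth_on_continuous U f s : smooth_on U f ->
  forall x, U x -> {for x, continuous (partials s f)}.
Proof. by move=> sf x Ux; apply: differentiable_continuous; exact: sf. Qed.

End calculus.

(** * Compactness of the ball and sphere, uniform positivity *)

Section compactness.
Context {R : realType}.

Lemma compact_lower_bound (T : topologicalType) (K : set T) (f : T -> R) :
  compact K -> (forall x, K x -> {for x, continuous f}) ->
  (forall x, K x -> 0 < f x) -> exists2 c : R, 0 < c & forall x, K x -> c <= f x.
Proof.
move=> cK cf f0; have [->|/set0P K0] := eqVneq K set0; first by exists 1.
have [|c /set_mem Kc fc] := compact_EVT_min K0 cK (f := f).
  by apply: continuous_in_subspaceT => x /set_mem; exact: cf.
by exists (f c); [exact: f0|move=> x Kx; apply: fc; exact: mem_set].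
Qed.

Lemma compact_norm_bound (T : topologicalType) (K : set T) (f : T -> R) :
  compact K -> (forall x, K x -> {for x, continuous f}) ->
  exists2 M : R, 0 < M & forall x, K x -> `|f x| <= M.
Proof.
move=> cK cf; have [->|/set0P K0] := eqVneq K set0; first by exists 1.
have [|c /set_mem Kc fc] := compact_EVT_max K0 cK (f := Num.norm \o f).
  apply: continuous_in_subspaceT => x /set_mem Kx.
  by apply: continuous_comp; [exact: cf|exact: norm_continuous].
exists (1 + `|f c|); first by rewrite ltr_pwDl.
by move=> x Kx; rewrite (le_trans (fc _ (mem_set Kx)))// lerDr.
Qed.

Lemma continuous_sum_at (T : topologicalType) (I : finType) (f : I -> T -> R) (x : T) :
  (forall i, {for x, continuous (f i)}) ->
  {for x, continuous (fun y => \sum_i f i y)}.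
Proof. by move=> cf; apply: cvg_big => [|i _]; [exact: add_continuous|exact: cf]. Qed.

Context {n : nat}.
Implicit Types (x v : 'rV[R]_n).

Lemma sqnorm_continuous : continuous (@sqnorm R n).
Proof. by move=> x; apply: differentiable_continuous; exact: differentiable_sqnorm. Qed.

Lemma sqnorm_ge0 x : 0 <= sqnorm x.
Proof. by apply: sumr_ge0 => i _; exact: sqr_ge0. Qed.

Lemma sqnorm_eq0 x : (sqnorm x == 0) = (x == 0).
Proof.
apply/eqP/eqP => [/eqP|->]; last by apply: big1 => i _; rewrite mxE expr0n.
rewrite psumr_eq0 => [/allP x0|i _]; last exact: sqr_ge0.
apply/rowP => i; rewrite mxE; apply/eqP.
by have := x0 i (mem_index_enum _); rewrite sqrf_eq0.
Qed.

Lemma sqnorm_gt0 x : (0 < sqnorm x) = (x != 0).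
Proof. by rewrite lt_def sqnorm_ge0 andbT sqnorm_eq0. Qed.

Lemma sqnormZ a x : sqnorm (a *: x) = a ^+ 2 * sqnorm x.
Proof. by rewrite /sqnorm mulr_sumr; apply: eq_bigr => i _; rewrite mxE exprMn. Qed.

Lemma sqnorm_mulmx x : (x *m x^T) ord0 ord0 = sqnorm x.
Proof. by rewrite mxE; apply: eq_bigr => i _; rewrite mxE expr2. Qed.

Lemma open_oball : open (@oball R n).
Proof.
have -> : oball n = @sqnorm R n @^-1` [set r | r < 1] by [].
by apply: open_comp; [move=> x _; exact: sqnorm_continuous|exact: open_lt].
Qed.

Lemma coord_le_sqnorm x i : x ord0 i ^+ 2 <= sqnorm x.
Proof. by rewrite /sqnorm (bigD1 i)//= lerDl sumr_ge0// => j _; exact: sqr_ge0. Qed.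

Lemma coord_le1 x i : cball n x -> `|x ord0 i| <= 1.
Proof.
move=> xB; rewrite -(ler_sqr (_ : _ \in Num.nneg)) ?nnegrE// expr1n -normrX.
by rewrite ger0_norm ?sqr_ge0// (le_trans (coord_le_sqnorm x i)).
Qed.

Lemma compact_cball : compact (@cball R n).
Proof.
apply: bounded_closed_compact; last first.
  have -> : cball n = @sqnorm R n @^-1` [set r | r <= 1] by [].
  by apply: closed_comp; [move=> x _; exact: sqnorm_continuous|exact: closed_le].
exists 1; split => // M M1 x xB; rewrite /Num.Def.normr/= mx_normrE.
apply: bigmax_le => [|[i j] _]; first by rewrite ltW// (lt_trans ltr01).
by rewrite /= (ord1 i) (le_trans (coord_le1 j xB))// ltW.
Qed.

Lemma sphere_cball : sphere n `<=` @cball R n.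
Proof. by move=> x; rewrite /sphere /cball /= => ->. Qed.

Lemma oball_cball : oball n `<=` @cball R n.
Proof. by move=> x /ltW. Qed.

Lemma compact_sphere : compact (@sphere R n).
Proof.
apply: subclosed_compact (compact_cball) (sphere_cball).
have -> : sphere n = @sqnorm R n @^-1` [set 1] by [].
by apply: closed_comp; [move=> x _; exact: sqnorm_continuous|exact: closed_eq].
Qed.

Lemma quadform_sum (A : 'M[R]_n) v :
  (v *m A *m v^T) ord0 ord0 = \sum_i \sum_j v ord0 i * v ord0 j * A i j.
Proof.
rewrite mxE exchange_big /=; apply: eq_bigr => j _.
rewrite !mxE mulr_suml; apply: eq_bigr => i _.
by rewrite mulrAC.
Qed.

Lemma quadformZ (A : 'M[R]_n) a v :
  ((a *: v) *m A *m (a *: v)^T) ord0 ord0 = a ^+ 2 * (v *m A *m v^T) ord0 ord0.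
Proof. by rewrite linearZ/= -!scalemxAl -scalemxAr scalerA [LHS]mxE expr2. Qed.

(** The form is a positive continuous function on the compact set of pairs (point of the ball, unit
    vector), so it has a positive minimum there; homogeneity of degree 2 in [v] extends the bound to
    all vectors. *)
Lemma posdef_uniform (A : 'rV[R]_n -> 'M[R]_n) :
  (forall x i j, cball n x -> {for x, continuous (fun y => A y i j)}) ->
  (forall x, cball n x -> posdef (A x)) ->
  exists2 c : R, 0 < c & forall x v, cball n x ->
    c * sqnorm v <= (v *m A x *m v^T) ord0 ord0.
Proof.
move=> cA pA.
pose F := fun p : 'rV[R]_n * 'rV[R]_n => (p.2 *m A p.1 *m p.2^T) ord0 ord0.
have [||c c0 cF] := compact_lower_bound (f := F) (compact_setX compact_cball compact_sphere).
- move=> [x v] [/= xB _].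
  rewrite (_ : F = fun p => \sum_i \sum_j p.2 ord0 i * p.2 ord0 j * A p.1 i j); last first.
    by apply/funext => p; rewrite /F quadform_sum.
  have c2 i : {for (x, v), continuous (fun p : 'rV[R]_n * 'rV[R]_n => p.2 ord0 i)}.
    apply: (@continuous_comp _ _ _ snd (fun y : 'rV[R]_n => y ord0 i)); first exact: cvg_snd.
    exact: coord_continuous.
  have c1 i j : {for (x, v), continuous (fun p : 'rV[R]_n * 'rV[R]_n => A p.1 i j)}.
    apply: (@continuous_comp _ _ _ fst (fun y => A y i j)); first exact: cvg_fst.
    exact: cA.
  have cS i j : {for (x, v), continuous (fun p : 'rV[R]_n * 'rV[R]_n =>
      p.2 ord0 i * p.2 ord0 j * A p.1 i j)}.
    exact: (continuousM (continuousM (c2 i) (c2 j)) (c1 i j)).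
  exact: (continuous_sum_at (fun i => continuous_sum_at (cS i))).
- move=> [x v] [/= xB vS]; apply: pA => //; rewrite -sqnorm_gt0.
  by move: vS; rewrite /sphere/= => ->.
exists c => // x v xB; have [->|v0] := eqVneq v 0.
  by rewrite -[X in sqnorm X](scale0r v) sqnormZ expr0n/= mul0r mulr0 !mul0mx mxE.
have s0 : 0 < sqnorm v by rewrite sqnorm_gt0.
set r := Num.sqrt (sqnorm v).
have r0 : 0 < r by rewrite sqrtr_gt0.
have : c <= F (x, r^-1 *: v).
  apply: cF; split => //=; rewrite /sphere/= sqnormZ exprVn sqr_sqrtr ?sqnorm_ge0//.
  by rewrite mulVf ?gt_eqF.
rewrite /F/= quadformZ exprVn sqr_sqrtr ?sqnorm_ge0//.
by rewrite ler_pdivlMl// [_ * c]mulrC.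
Qed.

End compactness.

(** * Curvature of conformal metrics *)

Section delta_sums.
Context {R : realType} {n : nat}.
(** Everything happens at one point: [p] and [H] stand for the gradient and Hessian of [Phi], and
    below [G k i j] for a Christoffel symbol and [dG l k i j] for its derivative in direction [l].
    The delta is a variable [dt], so that [ring] sees its values as atoms. *)
Variables (dt : 'I_n -> 'I_n -> R) (p v : 'I_n -> R) (H : 'I_n -> 'I_n -> R) (t : R).
Hypothesis dtE : forall i j, dt i j = (i == j)%:R.

Let dtC i j : dt i j = dt j i. Proof. by rewrite !dtE eq_sym. Qed.
Let dtii i : dt i i = 1. Proof. by rewrite dtE eqxx. Qed.

Lemma sum_dtl (F : 'I_n -> R) k : \sum_l dt l k * F l = F k.
Proof.
rewrite (bigD1 k)//= dtii mul1r big1 ?addr0// => l /negbTE lk.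
by rewrite dtE lk mul0r.
Qed.

Lemma sum_dtr (F : 'I_n -> R) k : \sum_l dt k l * F l = F k.
Proof. by under eq_bigr do rewrite dtC; exact: sum_dtl. Qed.

Variables (G : 'I_n -> 'I_n -> 'I_n -> R) (dG : 'I_n -> 'I_n -> 'I_n -> 'I_n -> R).
Hypothesis GE : forall k i j,
  G k i j = t * (dt j k * p i + dt i k * p j - dt i j * p k).
Hypothesis dGE : forall l k i j,
  dG l k i j = t * (dt j k * H l i + dt i k * H l j - dt i j * H l k).

(** The difference of the two Levi-Civita connections, [t (dPhi(X) N + dPhi(N) X - <X, N> grad
    Phi)]. *)
Lemma conformal_christoffel_sum (X N : 'I_n -> R) k :
  \sum_i \sum_j G k i j * X i * N j =
  t * (N k * (\sum_i X i * p i) + X k * (\sum_j N j * p j) - p k * \sum_i X i * N i).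
Proof.
transitivity (\sum_i t * (N k * (X i * p i) + dt i k * (X i * \sum_j N j * p j)
  - p k * (X i * N i))).
  apply: eq_bigr => i _.
  transitivity (t * (\sum_j dt j k * (X i * p i * N j)
    + dt i k * X i * (\sum_j N j * p j) - \sum_j dt i j * (p k * X i * N j))).
    rewrite [dt i k * X i * _]mulr_sumr -big_split/= -sumrB mulr_sumr.
    by apply: eq_bigr => j _; rewrite GE; ring.
  by rewrite sum_dtl sum_dtr; ring.
by rewrite -mulr_sumr sumrB big_split/= sum_dtl -!mulr_sumr.
Qed.

(** [H i j] and [H j i] are kept apart here; they merge in [conformal_quad_sum], after contraction
    with [v i * v j]. *)
Lemma conformal_ricci_sum i j :
  \sum_k (dG k k i j - dG j k i k
    + \sum_l (G k k l * G l i j - G k j l * G l i k)) =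
  t * (H i j + (1 - n%:R) * H j i - dt i j * \sum_k H k k)
  + t ^+ 2 * (n%:R - 2) * (p i * p j - dt i j * \sum_k p k ^+ 2).
Proof.
rewrite big_split/= sumrB.
under [X in _ + X]eq_bigr do rewrite sumrB.
rewrite sumrB; set S := \sum_k p k ^+ 2; set L := \sum_k H k k.
(* One term for each of the four sums. Since [G k k l = t * p l] and [dG j k i k = t * H j i] do not
   depend on [k], two of them are [n] equal copies. *)
transitivity (t * (H j i + H i j - dt i j * L)
  - n%:R * (t * H j i)
  + (n%:R * (t ^+ 2 * (2 * p i * p j - dt i j * S))
     - t ^+ 2 * ((n%:R + 2) * p i * p j - 2 * dt i j * S))); last by ring.
congr (_ - _ + (_ - _)).
- under eq_bigr do rewrite dGE.
  by rewrite -mulr_sumr sumrB big_split/= !sum_dtr mulr_sumr.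
- under eq_bigr => k _ do rewrite dGE dtii mul1r addrK.
  by rewrite sumr_const card_ord mulr_natl.
- transitivity (\sum_(k < n) (t ^+ 2 * (2 * p i * p j - dt i j * S))); last first.
    by rewrite sumr_const card_ord [RHS]mulr_natl.
  apply: eq_bigr => k _.
  transitivity (t ^+ 2 * (\sum_l dt j l * (p l * p i)
      + \sum_l dt i l * (p l * p j) - \sum_l dt i j * p l ^+ 2)).
    rewrite -big_split/= -sumrB mulr_sumr; apply: eq_bigr => l _.
    by rewrite !GE dtii (dtC k l); ring.
  by rewrite !sum_dtr -mulr_sumr -/S; ring.
- transitivity (\sum_k t ^+ 2 * (p j * p i + dt j k * (2 * p i * p k - dt i k * S)
     - (dt k j * (p k * p i) + dt i j * p k ^+ 2 - dt i k * (p k * p j)))).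
    apply: eq_bigr => k _.
    (* One sum over [l] for each of the three terms of [G k j l]; the middle one is expanded because
       its delta [dt j k] does not involve [l]. *)
    transitivity (t ^+ 2 * (
      \sum_l dt l k * (p j * (dt k l * p i + dt i l * p k - dt i k * p l))
      + \sum_l (dt k l * (dt j k * p l * p i) + dt i l * (dt j k * p l * p k)
           - dt j k * dt i k * p l ^+ 2)
      - \sum_l dt j l * (p k * (dt k l * p i + dt i l * p k - dt i k * p l)))).
      rewrite -big_split/= -sumrB mulr_sumr; apply: eq_bigr => l _.
      by rewrite !GE; ring.
    rewrite sum_dtl sum_dtr sumrB big_split/= !sum_dtr -mulr_sumr -/S dtii; ring.
  rewrite -mulr_sumr; congr (_ * _).
  rewrite sumrB big_split/= sumr_const card_ord sum_dtr.
  rewrite sumrB big_split/= -mulr_sumr -/S.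
  by rewrite sum_dtl sum_dtr -mulr_natl; ring.
Qed.

(** Swapping the summation indices identifies the two Hessian terms, whose coefficients [1] and
    [1 - m] add up to [- (m - 2)], the Hessian coefficient of [A_tensor]. *)
Lemma conformal_quad_sum (m L S : R) :
  \sum_i \sum_j v i * v j * (t * (H i j + (1 - m) * H j i - dt i j * L)
    + t ^+ 2 * (m - 2) * (p i * p j - dt i j * S)) =
  t * (\sum_i \sum_j v i * v j * (- (m - 2) * H i j - dt i j * L))
  + t ^+ 2 * (m - 2) * ((\sum_i v i * p i) ^+ 2 - S * \sum_i v i ^+ 2).
Proof.
set Q := \sum_i \sum_j v i * v j * H i j.
have QT : \sum_i \sum_j v i * v j * H j i = Q.
  rewrite /Q exchange_big/=; apply: eq_bigr => i _; apply: eq_bigr => j _.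
  by rewrite [v j * _]mulrC.
have DT : \sum_i \sum_j v i * v j * dt i j = \sum_i v i ^+ 2.
  apply: eq_bigr => i _; rewrite expr2 -(sum_dtr (fun j => v i * v j)).
  by apply: eq_bigr => j _; ring.
have PT : \sum_i \sum_j v i * v j * (p i * p j) = (\sum_i v i * p i) ^+ 2.
  rewrite expr2 mulr_suml; apply: eq_bigr => i _; rewrite mulr_sumr.
  by apply: eq_bigr => j _; ring.
(* Both sides of the goal are combinations of the same four contractions, so one expansion with free
   coefficients serves for both. *)
have key a b c e : \sum_i \sum_j v i * v j *
    (a * H i j + b * H j i + c * dt i j + e * (p i * p j)) =
    a * Q + b * Q + c * (\sum_i v i ^+ 2) + e * (\sum_i v i * p i) ^+ 2.
  transitivity (\sum_i (a * (\sum_j v i * v j * H i j)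
    + b * (\sum_j v i * v j * H j i) + c * (\sum_j v i * v j * dt i j)
    + e * (\sum_j v i * v j * (p i * p j)))).
    apply: eq_bigr => i _; rewrite !mulr_sumr -!big_split/=.
    by apply: eq_bigr => j _; ring.
  by rewrite !big_split/= -!mulr_sumr QT DT PT.
have -> : \sum_i \sum_j v i * v j * (- (m - 2) * H i j - dt i j * L) =
    - (m - 2) * Q - (\sum_i v i ^+ 2) * L.
  transitivity (- (m - 2) * Q + 0 * Q + (- L) * (\sum_i v i ^+ 2)
    + 0 * (\sum_i v i * p i) ^+ 2); last by ring.
  rewrite -key; apply: eq_bigr => i _; apply: eq_bigr => j _; ring.
transitivity (t * Q + t * (1 - m) * Q + (- (t * L) - t ^+ 2 * (m - 2) * S)
  * (\sum_i v i ^+ 2) + t ^+ 2 * (m - 2) * (\sum_i v i * p i) ^+ 2); last by ring.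
by rewrite -key; apply: eq_bigr => i _; apply: eq_bigr => j _; ring.
Qed.

End delta_sums.

(** * Christoffel symbols, Ricci tensor and second fundamental form of the conformal metric *)

Section conformal_geometry.
Context {R : realType} {n : nat}.
Variables (Phi : 'rV[R]_n -> R) (U : set 'rV[R]_n) (t : R).
Hypotheses (oU : open U) (sPhi : smooth_on U Phi).
Implicit Types (x y v X : 'rV[R]_n).
Let g := conformal t Phi.
Let p x i := partial i Phi x.
Let H x i j := partial i (partial j Phi) x.
Let dt (i j : 'I_n) : R := (i == j)%:R.

Let dtC i j : dt i j = dt j i. Proof. by rewrite /dt eq_sym. Qed.
Let dtii i : dt i i = 1. Proof. by rewrite /dt eqxx. Qed.

Lemma conformalE y a b : g y a b = expR (2 * t * Phi y) * dt a b.
Proof. by rewrite /g /conformal /euclidean !mxE. Qed.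

Lemma invmx_conformal y : invmx (g y) = (expR (2 * t * Phi y))^-1 *: 1%:M.
Proof. by rewrite /g /conformal /euclidean !scalemx1 invmx_scalar. Qed.

Lemma differentiable_expPhi x a : U x -> differentiable (fun y => expR (a * Phi y)) x.
Proof.
move=> Ux; have d : differentiable (fun y => a * Phi y) x.
  by apply: (@differentiableZ _ _ _ Phi a); exact: (sPhi [::]).
apply: (differentiable_comp d).
by apply/derivable1_diffP; exact: derivable_expR.
Qed.

Lemma derive_expPhi x v a : U x ->
  'D_v (fun y => expR (a * Phi y)) x = a * expR (a * Phi x) * 'D_v Phi x.
Proof.
move=> Ux; have dP := sPhi [::] Ux.
have d : differentiable (fun y => a * Phi y) x.
  by apply: (@differentiableZ _ _ _ Phi a).
have [_] := is_derive_comp v d (is_derive_expR (a * Phi x)).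
rewrite /comp => ->.
rewrite (_ : 'D_v (fun y => a * Phi y) x = a * 'D_v Phi x); first by ring.
by rewrite (@deriveZ _ _ _ Phi a)//; exact: diff_derivable.
Qed.

Lemma partial_conformal x i a b : U x ->
  partial i (fun y => g y a b) x = 2 * t * expR (2 * t * Phi x) * p x i * dt a b.
Proof.
move=> Ux; rewrite /partial.
under eq_fun do rewrite conformalE mulrC.
rewrite (@deriveZ _ _ _ (fun y => expR (2 * t * Phi y)) (dt a b)); last first.
  by apply: diff_derivable; exact: differentiable_expPhi.
by rewrite derive_expPhi// [LHS]mulrC.
Qed.

Lemma christoffel_conformal k i j x : U x ->
  christoffel g k i j x =
  t * (dt j k * p x i + dt i k * p x j - dt i j * p x k).
Proof.
move=> Ux; rewrite /christoffel.
transitivity (2^-1 * \sum_l dt l k * (2 * t * (p x i * dt j l + p x j * dt i l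
   - p x l * dt i j))).
  congr (_ * _); apply: eq_bigr => l _.
  rewrite invmx_conformal !partial_conformal// !mxE -/(dt k l) (dtC k l).
  have := lt0r_neq0 (expR_gt0 (2 * t * Phi x)).
  by move: (expR _) (p x i) (p x j) (p x l) (dt l k) (dt j l) (dt i l) (dt i j) => *; field.
rewrite (@sum_dtl _ _ dt (fun _ _ => erefl)).
by move: (p x i) (p x j) (p x k) (dt j k) (dt i k) (dt i j) => *; field.
Qed.

Lemma derive_christoffel k i j l x : U x ->
  partial l (christoffel g k i j) x =
  t * (dt j k * H x l i + dt i k * H x l j - dt i j * H x l k).
Proof.
move=> Ux; have d a : derivable (partial a Phi) x (delta_mx ord0 l).
  by apply: diff_derivable; exact: (sPhi [:: a]).
rewrite /partial (near_eq_derive (g := t \*: (dt j k \*: partial i Phi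
   + dt i k \*: partial j Phi - dt i j \*: partial k Phi))); last first.
  near=> y; rewrite christoffel_conformal//.
  by near: y; exact: open_nbhs_nbhs.
have D a : is_derive x (delta_mx ord0 l) (partial a Phi) (H x l a).
  exact: derivableP.
have [_ ->//] := is_deriveZ t (is_deriveB (is_deriveD (is_deriveZ (dt j k) (D i))
  (is_deriveZ (dt i k) (D j))) (is_deriveZ (dt i j) (D k))).
Unshelve. all: by end_near. Qed.

Lemma ricci_conformal x i j : U x ->
  ricci g x i j =
  t * (H x i j + (1 - n%:R) * H x j i - dt i j * laplacian Phi x)
  + t ^+ 2 * (n%:R - 2) * (p x i * p x j - dt i j * \sum_k p x k ^+ 2).
Proof.
move=> Ux; rewrite mxE; apply: (@conformal_ricci_sum R n dt (p x) (H x) t _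
  (fun k i j => christoffel g k i j x)
  (fun l k i j => partial l (christoffel g k i j) x)) => // *.
- exact: christoffel_conformal.
- exact: derive_christoffel.
Qed.

Lemma quadform_ricci x v : U x ->
  (v *m ricci g x *m v^T) ord0 ord0 =
  t * (v *m A_tensor Phi x *m v^T) ord0 ord0
  + t ^+ 2 * (n%:R - 2) * ((\sum_i v ord0 i * p x i) ^+ 2
     - (\sum_i p x i ^+ 2) * sqnorm v).
Proof.
move=> Ux; rewrite !quadform_sum.
under eq_bigr => i _ do under eq_bigr => j _ do rewrite ricci_conformal//.
rewrite (conformal_quad_sum (dt := dt))//.
congr (_ * _ + _); apply: eq_bigr => i _; apply: eq_bigr => j _.
by rewrite !mxE /dt mulr_natl.
Qed.

(** Stated off the sphere too, because [cov_deriv] differentiates the field in the ambient space. *)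
Lemma normal_conformal x : normal g x =
  ((Num.sqrt (expR (- (2 * t * Phi x)) * sqnorm x))^-1 * expR (- (2 * t * Phi x))) *: x.
Proof.
rewrite /normal /cosqnorm invmx_conformal -scalemxAr mulmx1 -scalemxAl scalerA.
by rewrite mxE sqnorm_mulmx expRN.
Qed.

Lemma gdot_conformal x X Y :
  gdot g x X Y = expR (2 * t * Phi x) * \sum_k X ord0 k * Y ord0 k.
Proof.
rewrite /gdot /g /conformal /euclidean -scalemxAr mulmx1 -scalemxAl [LHS]mxE.
by rewrite mxE; congr (_ * _); apply: eq_bigr => i _; rewrite mxE.
Qed.

(** The normal is a multiple of the position vector, so every radial term of its covariant
    derivative along [X] is killed by pairing with the tangent vector [X]. What is left is
    [h (1 + t d_nu Phi) X] with [h = e^(- t Phi)], and the metric contributes [e^(2 t Phi)]. *)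
Lemma second_form_conformal x X : U x -> sphere n x -> X *m x^T = 0 ->
  second_form g x X X = expR (t * Phi x) * (1 + t * 'D_x Phi x) * sqnorm X.
Proof.
move=> Ux xS Xx0.
have Xx : \sum_i X ord0 i * x ord0 i = 0.
  have := congr1 (fun M : 'M[R]_(1,1) => M ord0 ord0) Xx0; rewrite !mxE => E; rewrite -[RHS]E.
  by apply: eq_bigr => i _; rewrite mxE.
(* This is [e^(- t Phi) / |y|]. Its derivative only multiplies the radial vector [x], so
   differentiability suffices and no formula for it is computed. *)
pose h y := (Num.sqrt (expR (- (2 * t) * Phi y) * sqnorm y))^-1 * expR (- (2 * t) * Phi y).
have hE y : normal g y = h y *: y by rewrite normal_conformal /h !mulNr.
have hx : h x = expR (- (t * Phi x)).
  rewrite /h; move: (xS); rewrite /sphere/= => ->; rewrite mulr1.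
  have -> : - (2 * t) * Phi x = - (t * Phi x) + - (t * Phi x) by ring.
  rewrite expRD -expr2 sqrtr_sqr gtr0_norm ?expR_gt0// expr2 mulrA mulVf ?mul1r//.
  by rewrite gt_eqF// expR_gt0.
have dh : differentiable h x.
  have d1 := differentiable_expPhi (- (2 * t)) Ux.
  have d2 := differentiable_sqnorm x.
  have d3 := differentiableM d1 d2.
  have pos : 0 < expR (- (2 * t) * Phi x) * sqnorm x.
    by move: (xS); rewrite /sphere/= => ->; rewrite mulr1 expR_gt0.
  apply: differentiableM => //; apply: differentiableV; last first.
    by rewrite gt_eqF// sqrtr_gt0.
  apply: (differentiable_comp d3); apply/derivable1_diffP.
  by have [] := is_derive1_sqrt pos.
have hcoord k : is_derive x X (fun y => normal g y ord0 k)
    (h x * X ord0 k + x ord0 k * 'D_X h x).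
  have -> : (fun y => normal g y ord0 k) = (h * (fun y => y ord0 k))%R.
    by apply/funext => y; rewrite hE mxE.
  have D1 : is_derive x X h ('D_X h x) by apply: derivableP; exact: diff_derivable.
  exact: is_deriveM D1 (is_derive_coord x X k).
have DN k : ('D_X (normal g) x) ord0 k = h x * X ord0 k + x ord0 k * 'D_X h x.
  rewrite derive_mx; last first.
    by apply/derivable_mxP => i j; rewrite (ord1 i); have [] := hcoord j.
  by rewrite mxE; have [_ ->] := hcoord k.
have dP : 'D_x Phi x = \sum_i x ord0 i * p x i.
  by apply: derive_partial; exact: (sPhi [::]).
rewrite /second_form gdot_conformal.
have covE k : cov_deriv g X (normal g) x ord0 k =
    h x * X ord0 k + x ord0 k * 'D_X h x
    + t * h x * (x ord0 k * (\sum_i X ord0 i * p x i) + X ord0 k * 'D_x Phi x).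
  rewrite /cov_deriv mxE DN mxE; congr (_ + _).
  rewrite (@conformal_christoffel_sum R n dt (p x) t _
    (fun k i j => christoffel g k i j x)) => [|//|*]; last exact: christoffel_conformal.
  rewrite hE mxE.
  have -> : \sum_j (h x *: x) ord0 j * p x j = h x * 'D_x Phi x.
    by rewrite dP mulr_sumr; apply: eq_bigr => j _; rewrite mxE mulrA.
  have -> : \sum_i X ord0 i * (h x *: x) ord0 i = 0.
    transitivity (h x * \sum_i X ord0 i * x ord0 i); last by rewrite Xx mulr0.
    rewrite mulr_sumr; apply: eq_bigr => j _.
    by rewrite mxE mulrCA.
  rewrite mulr0 subr0.
  move: ('D_x Phi x) (\sum_i _) (h x) (x ord0 k) (X ord0 k) => *; ring.
have -> : \sum_k cov_deriv g X (normal g) x ord0 k * X ord0 k =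
    h x * (1 + t * 'D_x Phi x) * sqnorm X.
  transitivity (\sum_k (h x * (1 + t * 'D_x Phi x) * X ord0 k ^+ 2
     + ('D_X h x + t * h x * (\sum_i X ord0 i * p x i)) * (X ord0 k * x ord0 k))).
    apply: eq_bigr => k _; rewrite covE.
    move: ('D_X h x) ('D_x Phi x) (\sum_i _) (h x) (x ord0 k) (X ord0 k) => *; ring.
  by rewrite big_split/= -!mulr_sumr Xx mulr0 addr0.
rewrite hx !mulrA -expRD; congr (expR _ * _ * _); ring.
Qed.

End conformal_geometry.

(** * Small time and C^2-small perturbations *)

Section small_time.
Context {R : realType} {n : nat}.
Implicit Types (f h Phi : 'rV[R]_n -> R) (x v : 'rV[R]_n).

(** From [1 - z <= e^(- z)] one gets [e^z <= 1 / (1 - z)], and [(1 + z + 2 z^2) (1 - z) = 1 + z^2 (1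
    - 2 z) >= 1] for [z <= 1/2]. *)
Lemma expR_le_quadratic (z : R) : `|z| <= 2^-1 -> expR z <= 1 + z + 2 * z ^+ 2.
Proof.
rewrite ler_norml => /andP[z1 z2].
have z10 : 0 < 1 - z by lra.
have e1 : 1 - z <= expR (- z) := expR_ge1Dx (- z).
rewrite -[leLHS]invrK -expRN invf_ple ?posrE ?expR_gt0//; last by nra.
apply: le_trans e1; rewrite -div1r ler_pdivrMr; last by nra.
by have : 0 <= z ^+ 2 * (1 - 2 * z) by [apply: mulr_ge0; [exact: sqr_ge0|lra]]; nra.
Qed.

Lemma A_tensorE f x i j : A_tensor f x i j =
  - (n%:R - 2) * partials [:: i; j] f x
  + - (\sum_k partials [:: k; k] f x) * (i == j)%:R.
Proof. by rewrite !mxE mulr_natr mulNrn. Qed.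

Lemma A_tensor_continuous f U i j : smooth_on U f ->
  forall x, U x -> {for x, continuous (fun y => A_tensor f y i j)}.
Proof.
move=> sf x Ux.
rewrite (funext (fun y => A_tensorE f y i j)).
have lin (F G : 'rV[R]_n -> R) (a b : R) : {for x, continuous F} ->
    {for x, continuous G} -> {for x, continuous (fun y => a * G y + - F y * b)}.
  move=> cF cG; apply: (@cvgD _ _ _ (nbhs x)); last exact: cvgMr_tmp (cvgN cF).
  exact: cvgMl_tmp cG.
apply: (lin (fun y => \sum_k partials [:: k; k] f y)).
  exact: continuous_sum_at (fun k => smooth_on_continuous (s := [:: k; k]) sf Ux).
exact: (smooth_on_continuous (s := [:: i; j]) sf Ux).
Qed.

Lemma partials_bound f s : smooth_cball f ->
  exists2 M : R, 0 < M & forall x, cball n x -> `|partials s f x| <= M.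
Proof.
move=> [U [_ BU sf]]; apply: compact_norm_bound; first exact: compact_cball.
by move=> x /BU; exact: smooth_on_continuous.
Qed.

Lemma ricci_positive_small Phi : (2 <= n)%N -> smooth_cball Phi ->
  (forall x, cball n x -> posdef (A_tensor Phi x)) ->
  exists2 t0 : R, 0 < t0 & forall t, 0 < t < t0 ->
    forall x, cball n x -> posdef (ricci (conformal t Phi) x).
Proof.
move=> n2 sP pA; have [U [oU BU sf]] := sP.
have [|//|c c0 cA] := @posdef_uniform R n (A_tensor Phi).
  by move=> x i j /BU; exact: A_tensor_continuous.
have [M M0 PM] : exists2 M : R, 0 < M & forall x, cball n x ->
    \sum_i partial i Phi x ^+ 2 <= M.
  have [|M M0 PM] := compact_norm_bound (f := fun x => \sum_i partial i Phi x * partial i Phi x)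
    (@compact_cball R n).
    move=> x /BU Ux; apply: continuous_sum_at => i.
    by apply: continuousM; exact: (smooth_on_continuous (s := [:: i]) sf).
  exists M => // x /PM; apply: le_trans.
  by rewrite (le_trans _ (ler_norm _))// ler_sum// => i _; rewrite expr2.
have n20 : 0 <= n%:R - 2 :> R by rewrite subr_ge0 ler_nat.
(* The square of [dPhi(v)] enters with a nonnegative coefficient and is dropped; what remains is at
   least [t |v|^2 (c - t (n - 2) M)]. The added 1 keeps the denominator positive when [n = 2]. *)
exists (c / ((n%:R - 2) * M + 1)).
  by rewrite divr_gt0// ltr_wpDl// mulr_ge0// ltW.
move=> t /andP[t0]; rewrite ltr_pdivlMr; last by rewrite ltr_wpDl// mulr_ge0// ltW.
move=> tc x xB v v0; rewrite (quadform_ricci t oU sf)//; last exact: BU.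
have := cA x v xB; have := PM x xB; rewrite -sqnorm_gt0 in v0.
move: v0 (sqr_ge0 (\sum_i v ord0 i * partial i Phi x)).
move: ((\sum_i v ord0 i * partial i Phi x) ^+ 2) (sqnorm v) (\sum_i partial i Phi x ^+ 2)
  ((v *m A_tensor Phi x *m v^T) ord0 ord0) (n%:R - 2 : R) n20 tc => a s S A m m0 tc s0 a0 SM cs.
have h1 : 0 <= t ^+ 2 * m * a.
  by apply: mulr_ge0 => //; apply: mulr_ge0 => //; exact: sqr_ge0.
have h2 : t ^+ 2 * m * (S * s) <= t ^+ 2 * m * (M * s).
  by apply: ler_wpM2l; [apply: mulr_ge0 => //; exact: sqr_ge0|rewrite ler_wpM2r// ltW].
have h3 : t * (c * s) <= t * A by rewrite ler_wpM2l// ltW.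
have h4 : 0 < t * s * (c - t * (m * M + 1)) by rewrite !mulr_gt0// subr_gt0.
have h5 : 0 < t * s * t by rewrite !mulr_gt0.
by rewrite mulrBr; nra.
Qed.

Lemma q_bdry_sum f U x : smooth_on U f -> U x ->
  q_bdry f x = \sum_i x ord0 i * partial i f x - f x.
Proof. by move=> sf Ux; rewrite /q_bdry derive_partial//; exact: (sf [::]). Qed.

Lemma q_bdry_lower Phi : smooth_cball Phi ->
  (forall x, sphere n x -> 0 < q_bdry Phi x) ->
  exists2 c : R, 0 < c & forall x, sphere n x -> c <= q_bdry Phi x.
Proof.
move=> [U [oU BU sf]] q0.
have SU : sphere n `<=` U by move=> x /sphere_cball /BU.
have [||c c0 cq] := compact_lower_bound
  (f := fun x => \sum_i x ord0 i * partial i Phi x - Phi x) (@compact_sphere R n).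
- move=> x /SU Ux; apply: continuousB; last exact: (smooth_on_continuous (s := [::]) sf).
  apply: continuous_sum_at => i; apply: continuousM; first exact: coord_continuous.
  exact: (smooth_on_continuous (s := [:: i]) sf).
- by move=> x xS; rewrite -(q_bdry_sum sf)//; [exact: q0|exact: SU].
by exists c => // x xS; rewrite (q_bdry_sum sf)//; [exact: cq|exact: SU].
Qed.

(** After division by [e^(t Phi) |X|^2] the claim is [e^(t Phi) < 1 + t d_nu Phi]; by the quadratic
    bound it follows from [2 t Phi^2 < q_bdry Phi]. *)
Lemma second_form_gt_small Phi : smooth_cball Phi ->
  (forall x, sphere n x -> 0 < q_bdry Phi x) ->
  exists2 t0 : R, 0 < t0 & forall t, 0 < t < t0 -> forall x X, sphere n x ->
    X *m x^T = 0 -> X != 0 ->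
    gdot (conformal t Phi) x X X < second_form (conformal t Phi) x X X.
Proof.
move=> sP q0; have [c c0 cq] := q_bdry_lower sP q0.
have [M M0 PM] := partials_bound [::] sP.
have [U [oU BU sf]] := sP.
(* The first summand makes [t |Phi| <= 1/2], where the quadratic bound is valid; the second makes
   [2 t M^2 < c]. *)
have K0 : 0 < 2 * M + 2 * M ^+ 2 / c by rewrite addr_gt0// ?divr_gt0 ?mulr_gt0// exprn_gt0.
exists ((2 * M + 2 * M ^+ 2 / c)^-1); first by rewrite invr_gt0.
move=> t /andP[t0 tK] x X xS Xx X0.
have Bx := sphere_cball xS.
rewrite (second_form_conformal t sf)//; last exact: BU.
rewrite gdot_conformal (_ : \sum_k _ = sqnorm X); last first.
  by apply: eq_bigr => i _; rewrite expr2.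
rewrite ltr_pM2r ?sqnorm_gt0//.
have -> : 2 * t * Phi x = t * Phi x + t * Phi x by ring.
rewrite expRD ltr_pM2l ?expR_gt0//.
have tM : t * (2 * M) < 1 /\ t * (2 * M ^+ 2) < c.
  move: tK; rewrite -[_^-1]div1r ltr_pdivlMr// mulrDr => tK; split.
    apply: le_lt_trans tK; rewrite lerDl mulr_ge0// ?ltW// divr_gt0// mulr_gt0// exprn_gt0//.
  rewrite -[ltRHS]mul1r -ltr_pdivrMr// -mulrA; apply: le_lt_trans tK.
  by rewrite lerDr mulr_ge0// ltW// mulr_gt0.
have PMx := PM _ Bx; rewrite /= in PMx.
have tP : `|t * Phi x| <= 2^-1.
  rewrite normrM (gtr0_norm t0).
  have : t * `|Phi x| <= t * M by rewrite ler_pM2l.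
  by case: tM; lra.
apply: le_lt_trans (expR_le_quadratic tP) _.
have : Phi x ^+ 2 <= M ^+ 2 by rewrite -real_normK ?num_real// ler_pXn2r// nnegrE ltW.
have := cq _ xS; rewrite /q_bdry.
case: tM => _; move: ('D_x Phi x) (Phi x) => D P tM cD PP.
have : t * (2 * t * P ^+ 2) < t * (D - P).
  rewrite ltr_pM2l//; apply: lt_le_trans cD; apply: le_lt_trans tM.
  have := ltW t0; nra.
by rewrite exprMn; nra.
Qed.

(** Replaces the extended-real supremum of [C2_norm] by pointwise real bounds, on differences of
    partials instead of partials of a difference. *)
Definition C2_close (e : R) f h := forall s x, (size s <= 2)%N -> cball n x ->
  `|partials s h x - partials s f x| <= e.

Lemma C2_close_norm e f h : smooth_cball f -> smooth_cball h ->
  (C2_norm (fun x => (h x - f x)%R) < e%:E)%E -> C2_close e f h.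
Proof.
move=> [U [oU BU sf]] [V [oV BV sh]] he s x s2 xB.
have UVx : (U `&` V) x by split; [exact: BU|exact: BV].
have := partials_lin (-1) (openI oU oV) (smooth_onS (@subIsetr _ _ _) sh)
  (smooth_onS (@subIsetl _ _ _) sf) s UVx.
under [X in partials s X x]eq_fun do rewrite mulN1r.
rewrite mulN1r => <-; rewrite -lee_fin; apply: le_trans (ltW he).
by apply: ereal_sup_ubound; exists s, x.
Qed.

Lemma C2_closeW e e' f h : e <= e' -> C2_close e f h -> C2_close e' f h.
Proof. by move=> ee ch s x s2 xB; exact: le_trans (ch s x s2 xB) ee. Qed.

Lemma A_tensor_posdef_open f : smooth_cball f ->
  (forall x, cball n x -> posdef (A_tensor f x)) ->
  exists2 e : R, 0 < e & forall h, C2_close e f h ->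
    forall x, cball n x -> posdef (A_tensor h x).
Proof.
move=> [U [oU BU sf]] pA.
have [|//|c c0 cA] := @posdef_uniform R n (A_tensor f).
  by move=> x i j /BU; exact: A_tensor_continuous.
(* An entry of [A_tensor] moves by at most [K e]: [|n - 2|] from the Hessian entry, [n] from the
   Laplacian. Summing [n^2] entries moves the form by at most [n^2 K e |v|^2], and the 1 added in
   [N] makes this strictly less than [c |v|^2]. *)
pose K : R := `|n%:R - 2| + n%:R; have K0 : 0 <= K by rewrite addr_ge0.
pose N : R := n%:R ^+ 2 * K + 1.
have N0 : 0 < N by rewrite ltr_wpDl// mulr_ge0// sqr_ge0.
exists (c / N); first by rewrite divr_gt0.
move=> h ch x xB v v0; rewrite -sqnorm_gt0 in v0; set e := c / N in ch.
have Ne : N * e = c by rewrite /e mulrCA divff ?mulr1// gt_eqF.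
have e0 : 0 < e by rewrite divr_gt0.
have Aij i j : `|A_tensor h x i j - A_tensor f x i j| <= K * e.
  have alg (r a b S T k : R) :
    (- r * a + - S * k) - (- r * b + - T * k) = - r * (a - b) - (S - T) * k by ring.
  have bnd (r a S k : R) : `|a| <= e -> `|S| <= n%:R * e -> `|k| <= 1 ->
      `|- r * a - S * k| <= (`|r| + n%:R) * e.
    move=> ae Se k1; rewrite (le_trans (ler_normB _ _))// mulrDl lerD//.
      by rewrite normrM normrN ler_wpM2l.
    by rewrite normrM -[leRHS]mulr1 ler_pM.
  have E := etrans (congr2 (fun a b => a - b) (A_tensorE h x i j) (A_tensorE f x i j))
    (alg (n%:R - 2) (partials [:: i; j] h x) (partials [:: i; j] f x)
      (\sum_k partials [:: k; k] h x) (\sum_k partials [:: k; k] f x) (i == j)%:R).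
  rewrite /= in E; rewrite E.
  apply: (bnd (n%:R - 2) (partials [:: i; j] h x - partials [:: i; j] f x)
    (\sum_k partials [:: k; k] h x - \sum_k partials [:: k; k] f x) (i == j)%:R).
  - exact: (ch [:: i; j]).
  - rewrite -sumrB (le_trans (ler_norm_sum _ _ _))//.
    rewrite -[n in n%:R]card_ord mulr_natl -sumr_const ler_sum// => k _.
    exact: (ch [:: k; k]).
  - by rewrite normr_nat lern1 leq_b1.
move: (A_tensor h x) (A_tensor f x) Aij (cA x v xB) => B A Aij.
rewrite !quadform_sum => cv.
have : \sum_i \sum_j v ord0 i * v ord0 j * A i j
   - \sum_i \sum_j v ord0 i * v ord0 j * B i j <= n%:R ^+ 2 * K * e * sqnorm v.
  rewrite -sumrB; apply: le_trans (_ : \sum_(i < n) \sum_(j < n) (K * e * sqnorm v) <= _); last first.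
    rewrite le_eqVlt; apply/orP; left; apply/eqP.
    by rewrite !sumr_const !card_ord -mulrnA -[LHS]mulr_natr natrM; ring.
  apply: ler_sum => i _; rewrite -sumrB; apply: ler_sum => j _.
  rewrite -mulrBr (le_trans (ler_norm _))// normrM mulrC ler_pM//; first by rewrite distrC.
  (* [|v i| |v j| <= |v|^2] is proved by comparing squares. *)
  rewrite normrM -(ger0_norm (sqnorm_ge0 v)) -(@ler_pXn2r _ 2)// ?nnegrE//.
  rewrite exprMn -!normrX ger0_norm ?sqr_ge0// ger0_norm ?sqr_ge0//.
  by rewrite ger0_norm ?sqr_ge0// expr2 ler_pM ?sqr_ge0// coord_le_sqnorm.
have : n%:R ^+ 2 * K * e * sqnorm v < c * sqnorm v.
  by rewrite ltr_pM2r// -Ne /N mulrDl mul1r ltrDl.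
move=> a b; rewrite -subr_gt0; lra.
Qed.

Lemma q_bdry_pos_open f : smooth_cball f ->
  (forall x, sphere n x -> 0 < q_bdry f x) ->
  exists2 e : R, 0 < e & forall h, smooth_cball h -> C2_close e f h ->
    forall x, sphere n x -> 0 < q_bdry h x.
Proof.
move=> sf q0; have [c c0 cq] := q_bdry_lower sf q0.
have [U [oU BU {}sf]] := sf.
(* The normal derivative moves by at most [n e], coordinates being at most 1 in absolute value, and
   the function by at most [e]; the remaining [e] gives strictness. *)
exists (c / (n%:R + 2)); first by rewrite divr_gt0.
move=> h [V [oV BV sh]] ch x xS; have xB := sphere_cball xS.
have := cq x xS; rewrite (q_bdry_sum sf (BU _ xB)) (q_bdry_sum sh (BV _ xB)).
set e := c / _ in ch.
have e0 : 0 < e by rewrite divr_gt0.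
have Ne : (n%:R + 2) * e = c by rewrite /e mulrCA divff ?mulr1// gt_eqF.
have h1 : `|\sum_i x ord0 i * partial i h x - \sum_i x ord0 i * partial i f x| <= n%:R * e.
  rewrite -sumrB (le_trans (ler_norm_sum _ _ _))//.
  rewrite -[n in n%:R]card_ord mulr_natl -sumr_const ler_sum// => i _.
  rewrite -mulrBr normrM -[leRHS]mul1r ler_pM//; first exact: coord_le1.
  exact: (ch [:: i]).
have h2 : `|h x - f x| <= e := ch [::] x isT xB.
move: h1 h2; rewrite !ler_norml => /andP[h11 h12] /andP[h21 h22]; nra.
Qed.

End small_time.

(** * Lebesgue measure on the ball and the graph charts of the sphere *)

Section rV_measure.
Context {R : realType}.

(** The sigma-algebra is generated by the coordinates, so [A] is written as the countable union of
    the boxes it contains that have a rational centre and half-side [1 / (k + 1)]. *)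
Lemma open_measurable_rV n (A : set 'rV[R]_n) : open A -> measurable A.
Proof.
move=> oA.
pose box (q : 'rV[rat]_n * nat) : set 'rV[R]_n := \bigcap_(i in [set: 'I_n])
  [set x : 'rV[R]_n | `]ratr (q.1 ord0 i) - q.2.+1%:R^-1,
     ratr (q.1 ord0 i) + q.2.+1%:R^-1[%classic (x ord0 i)].
have mbox q : measurable (box q).
  apply: fin_bigcap_measurable => // i _.
  rewrite -[X in measurable X]setTI.
  exact: (@measurable_coord R n i measurableT _ (measurable_itv _)).
pose F q := if `[< box q `<=` A >] then box q else set0.
have -> : A = \bigcup_q F q.
  apply/seteqP; split => [x Ax|x [q _]]; last by rewrite /F; case: asboolP => // + ?; exact.
  have /nbhs_ballP[e /= e0 eA] := open_nbhs_nbhs (conj oA Ax).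
  (* With [2 r < e], a box of half-side [r] that contains [x] stays within sup-distance [e] of
     [x]. *)
  pose k := Num.truncn (2 / e); pose r : R := k.+1%:R^-1.
  have r0 : 0 < r by rewrite invr_gt0.
  have re : 2 * r < e.
    have := truncnS_gt (2 / e); rewrite -/k ltr_pdivrMr// mulrC -ltr_pdivrMr//.
  have /choice[q qP] : forall i, exists q : rat, ratr q \in `]x ord0 i - r, x ord0 i + r[.
    by move=> i; apply: rat_in_itvoo; lra.
  exists (\row_i q i, k) => //; rewrite /F asboolT; last first.
    move=> y yq; apply: eA; split => // i j; rewrite (ord1 i).
    have := yq j I; have := qP j; rewrite /= !in_itv/= mxE -/r.
    move=> /andP[a1 a2] /andP[b1 b2]; rewrite /ball/= ltr_norml; apply/andP; split; lra.
  move=> i _ /=; have := qP i; rewrite !in_itv/= mxE -/r.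
  by move=> /andP[a1 a2]; apply/andP; split; lra.
apply: countable_bigcupT_measurable => [|q]; first exact: countableP.
by rewrite /F; case: asboolP.
Qed.

Lemma continuous_measurable_rV n (U : set 'rV[R]_n) (f : 'rV[R]_n -> R) : open U ->
  (forall x, U x -> {for x, continuous f}) -> measurable_fun U f.
Proof.
move=> oU cf; apply: (measurability _ (RGenOpens.measurableE R)).
move=> _ [_ [a [b ->] <-]]; apply: open_measurable_rV; rewrite openE => x [Ux fx].
apply: filterI; first exact: open_nbhs_nbhs.
by apply: (cf x Ux); exact: open_nbhs_nbhs.
Qed.

Lemma measurable_oball n : measurable (@oball R n).
Proof. by apply: open_measurable_rV; exact: open_oball. Qed.

Lemma measurable_sqnorm n : measurable_fun [set: 'rV[R]_n] (@sqnorm R n).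
Proof.
by apply: continuous_measurable_rV => [|x _]; [exact: openT|exact: sqnorm_continuous].
Qed.

(** Both the coordinate [x_1] of the upper graph chart and half the length of the chord of the ball
    over [y]. *)
Definition height n (y : 'rV[R]_n) : R := Num.sqrt (1 - sqnorm y).

Lemma height_ge0 n (y : 'rV[R]_n) : 0 <= height y.
Proof. exact: sqrtr_ge0. Qed.

Lemma height_gt0 n (y : 'rV[R]_n) : oball n y -> 0 < height y.
Proof. by move=> y1; rewrite sqrtr_gt0 subr_gt0. Qed.

Lemma height_le1 n (y : 'rV[R]_n) : height y <= 1.
Proof.
by rewrite -[leRHS]sqrtr1 ler_wsqrtr// lerBlDr lerDl; exact: sqnorm_ge0.
Qed.

Lemma sqr_height n (y : 'rV[R]_n) : oball n y -> height y ^+ 2 = 1 - sqnorm y.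
Proof. by move=> y1; rewrite sqr_sqrtr// subr_ge0 ltW. Qed.

Lemma measurable_height n : measurable_fun [set: 'rV[R]_n] (@height n).
Proof.
have ms : measurable_fun [set: R] (@Num.sqrt R).
  by apply: continuous_measurable_fun; exact: sqrt_continuous.
have mb : measurable_fun [set: 'rV[R]_n] (fun y => 1 - sqnorm y).
  by apply: measurable_funB => //; exact: measurable_sqnorm.
exact: measurableT_comp ms mb.
Qed.

Lemma rV_cons0 n a (y : 'rV[R]_n) : rV_cons (a, y) ord0 ord0 = a.
Proof. by rewrite /rV_cons mxE; case: splitP => // j _; rewrite (ord1 j) mxE eqxx mulr1n. Qed.

Lemma rV_consS n a (y : 'rV[R]_n) j : rV_cons (a, y) ord0 (lift ord0 j) = y ord0 j.
Proof.
rewrite /rV_cons mxE; case: splitP => [i /= | i /eqP /=].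
  by rewrite (ord1 i) /bump leq0n.
by rewrite /bump leq0n eqn_add2l => /eqP /val_inj ->.
Qed.

Lemma sqnorm_cons n a (y : 'rV[R]_n) : sqnorm (rV_cons (a, y)) = a ^+ 2 + sqnorm y.
Proof.
rewrite /sqnorm big_ord_recl rV_cons0; congr (_ + _).
by apply: eq_bigr => i _; rewrite rV_consS.
Qed.

Lemma lebesgue_rVS n (A : set 'rV[R]_n.+1) :
  lebesgue_rV R n.+1 A = ((@lebesgue_measure R) \x lebesgue_rV R n)%E (@rV_cons R n @^-1` A).
Proof. by []. Qed.

Lemma measurable_preimage_cons n (A : set 'rV[R]_n.+1) : measurable A ->
  measurable (@rV_cons R n @^-1` A).
Proof. by move=> mA; rewrite -[X in measurable X]setTI; exact: measurable_rV_cons. Qed.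

Lemma lebesgue_rVS_ysection n (A : set 'rV[R]_n.+1) : measurable A ->
  lebesgue_rV R n.+1 A =
  (\int[lebesgue_rV R n]_y (@lebesgue_measure R) (ysection (@rV_cons R n @^-1` A) y))%E.
Proof.
move=> mA; rewrite lebesgue_rVS; have mB := measurable_preimage_cons mA.
have := indic_fubini_tonelli (@lebesgue_measure R) (lebesgue_rV R n) mB.
by rewrite indic_fubini_tonelli_FE// indic_fubini_tonelli_GE// => <-.
Qed.

(** Tonelli: the section of the ball over [y] is the interval of radius [height y] if [|y| < 1], and
    is empty otherwise. *)
Lemma lebesgue_oballS n : lebesgue_rV R n.+1 (oball n.+1) =
  (\int[lebesgue_rV R n]_(y in oball n) (2 * height y)%:E)%E.
Proof.
rewrite lebesgue_rVS_ysection; last exact: measurable_oball.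
rewrite [RHS]integral_mkcond; apply: eq_integral => y _; rewrite patchE.
have secE a : ysection (@rV_cons R n @^-1` oball n.+1) y a <-> a ^+ 2 < 1 - sqnorm y.
  by rewrite /ysection/= inE /oball/= sqnorm_cons ltrBrDr.
case: ifPn => [/set_mem yB|/negP yB].
  have -> : ysection (@rV_cons R n @^-1` oball n.+1) y = `]- height y, height y[%classic.
    apply/seteqP; split => a; rewrite secE -sqr_height//= in_itv/= -ltr_norml;
      by rewrite -[a ^+ 2]real_normK ?num_real// ltr_pXn2r// nnegrE height_ge0.
  rewrite lebesgue_measure_itv/= lte_fin gtrN ?height_gt0//.
  by rewrite -EFinB opprK -mulr2n mulr_natl.
have -> : ysection (@rV_cons R n @^-1` oball n.+1) y = set0; last by rewrite measure0.
apply/seteqP; split => // a; rewrite secE => a1.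
apply: yB; apply: mem_set; rewrite /oball/= -subr_gt0; apply: le_lt_trans a1.
exact: sqr_ge0.
Qed.

(** Induction on the dimension: chords have length at most 2, and in dimension 0 the measure is a
    Dirac mass. *)
Lemma lebesgue_oball_lty n : (lebesgue_rV R n (oball n) < +oo)%E.
Proof.
elim: n => [|n IH]; first by rewrite /= diracE ltry.
rewrite lebesgue_oballS (@le_lt_trans _ _ (\int[lebesgue_rV R n]_(y in oball n) (cst 2%:E y))%E)//.
  apply: ge0_le_integral => //; first exact: measurable_oball.
  - by move=> y _; rewrite lee_fin mulr_ge0// height_ge0.
  - apply/measurable_EFinP; apply: measurable_funM => //.
    exact: measurable_funTS (@measurable_height n).
  - by move=> y _; rewrite lee_fin ler_piMr// height_le1.
by rewrite integral_cst ?lte_mul_pinfty//; exact: measurable_oball.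
Qed.

Lemma lebesgue_hyperplane n : lebesgue_rV R n.+1 [set x | x ord0 ord0 = 0] = 0%E.
Proof.
rewrite lebesgue_rVS (_ : _ @^-1` _ = [set (0 : R)] `*` setT).
  by rewrite product_measure1E//= lebesgue_measure_set1 mul0e.
apply/seteqP; split => -[a y] /=; first by rewrite rV_cons0.
by move=> [-> _]; rewrite rV_cons0.
Qed.

End rV_measure.

(** Multiplying a block triangular matrix of determinant [\det (1 + u v)] on both sides by unipotent
    blocks turns it into one of determinant [1 + v u]. *)
Lemma det_1_plus_rank1 (R : comNzRingType) n (u : 'cV[R]_n) (v : 'rV[R]_n) :
  \det (1%:M + u *m v) = 1 + (v *m u) ord0 ord0.
Proof.
have E : block_mx 1%:M 0 v (1%:M : 'M[R]_(1, 1)) *m block_mx (1%:M + u *m v) u 0 1%:M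
    *m block_mx 1%:M 0 (- v) 1%:M = block_mx 1%:M u 0 (1%:M + v *m u).
  rewrite !mulmx_block !mulmx1 !mul1mx !mul0mx !mulmx0 !add0r !addr0.
  congr block_mx.
  - by rewrite mulmxN addrK.
  - rewrite mulmxDr mulmx1 mulmxDl mul1mx mulmxN mulmxA.
    by rewrite addrA addrK subrr.
  - by rewrite addrC.
have := congr1 determinant E.
rewrite !det_mulmx !det_lblock !det_ublock !det1 !mul1r !mulr1 => ->.
by rewrite det_mx11 !mxE eqxx.
Qed.

(** * Jacobian and area density of the graph charts *)

Section hemisphere_chart.
Context {R : realType} {d : nat}.
Implicit Types (y : 'rV[R]_d) (b : bool).

Lemma hemisphere_sphere b y : oball d y -> sphere d.+1 (hemisphere b y).
Proof.
move=> yB; rewrite /sphere/= sqnorm_cons exprMn -exprM mulnC exprM sqrrN expr1n expr1n mul1r.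
by rewrite -/(height y) sqr_height// subrK.
Qed.

Lemma measurable_hemisphere b : measurable_fun setT (@hemisphere R d b).
Proof.
apply: (@measurableT_comp _ _ _ _ _ _ _ _ (fun y : 'rV[R]_d => ((-1) ^+ b * height y, y))).
  exact: measurable_rV_cons.
apply: measurable_fun_pair => //; apply: measurable_funM => //.
exact: measurable_height.
Qed.

Lemma differentiable_onem_sqnorm y : differentiable (fun z : 'rV[R]_d => 1 - sqnorm z) y.
Proof.
have -> : (fun z : 'rV[R]_d => 1 - sqnorm z) = cst 1 - @sqnorm R d by [].
by apply: differentiableB; [exact: differentiable_cst|exact: differentiable_sqnorm].
Qed.

Lemma is_derive_height y v : oball d y ->
  is_derive y v (@height R d) (- (\sum_i v ord0 i * y ord0 i) / height y).
Proof.
move=> yB; have pos : 0 < 1 - sqnorm y by rewrite subr_gt0.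
have sE : (fun z => 1 - sqnorm z) = cst 1 - \sum_i (fun z : 'rV[R]_d => z ord0 i) ^+ 2.
  by apply/funext => z; rewrite !fctE /= fct_sumE.
have ds := differentiable_onem_sqnorm y.
have D1 : is_derive y v (fun z : 'rV[R]_d => 1 - sqnorm z)
    (0 - \sum_i (2%:R * (y ord0 i) ^+ 1) *: v ord0 i).
  rewrite sE; apply: is_deriveB; apply: is_derive_sum => i.
  exact: (is_deriveX 2 (is_derive_coord y v i)).
have := is_derive_comp v ds (is_derive1_sqrt pos).
have [_ ->] := D1; rewrite /comp -/(height _) => D2.
apply: is_derive_eq D2 _; rewrite sub0r.
have -> : \sum_i (2%:R * (y ord0 i) ^+ 1) *: v ord0 i = 2 * \sum_i v ord0 i * y ord0 i.
  by rewrite mulr_sumr; apply: eq_bigr => i _; rewrite expr1 /GRing.scale/= -mulrA [y _ _ * _]mulrC.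
have := height_gt0 yB; rewrite -/(height y).
by move: (\sum_i _) (height y) => a h h0; field; exact: lt0r_neq0.
Qed.

(** Writes the chart as scalar functions times fixed basis vectors, so that differentiability
    reduces to that of [height] and of the coordinates. *)
Lemma hemisphereE b y : hemisphere b y = ((-1) ^+ b * height y) *: delta_mx ord0 ord0
  + \sum_i y ord0 i *: delta_mx ord0 (lift ord0 i).
Proof.
apply/rowP => j; have -> : (((-1) ^+ b * height y) *: delta_mx ord0 ord0
    + \sum_i y ord0 i *: delta_mx ord0 (lift ord0 i) : 'rV[R]_d.+1) ord0 j =
    (-1) ^+ b * height y * (j == ord0)%:R + \sum_i y ord0 i * (j == lift ord0 i)%:R.
  rewrite !mxE summxE /=; congr (_ + _).
  by apply: eq_bigr => i _; rewrite !mxE.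
have [k ->|->] := unliftP ord0 j.
  rewrite [LHS]rV_consS mulr0 add0r (bigD1 k)//= eqxx mulr1 big1 ?addr0//.
  by move=> i ik; rewrite (inj_eq (@lift_inj _ _)) eq_sym (negbTE ik) mulr0.
by rewrite [LHS]rV_cons0 eqxx mulr1 big1 ?addr0// => i _; rewrite mulr0.
Qed.

Lemma differentiable_hemisphere b y : oball d y -> differentiable (@hemisphere R d b) y.
Proof.
move=> yB; rewrite (funext (hemisphereE b)).
have dh : differentiable (@height R d) y.
  have pos : 0 < 1 - sqnorm y by rewrite subr_gt0.
  apply: (differentiable_comp (differentiable_onem_sqnorm y)).
  by apply/derivable1_diffP; have [] := is_derive1_sqrt pos.
apply: differentiableD.
  apply: differentiableZl.
  by apply: (@differentiableZ _ _ _ (@height R d) ((-1) ^+ b)).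
have := @differentiable_sum R _ _ d (fun i (z : 'rV[R]_d) =>
  z ord0 i *: (delta_mx ord0 (lift ord0 i) : 'rV[R]_d.+1)) y.
rewrite (_ : \sum_(i < d) _ = (fun z : 'rV[R]_d =>
    \sum_i z ord0 i *: delta_mx ord0 (lift ord0 i))); last first.
  by apply/funext => z; rewrite fct_sumE.
by apply => i; apply: differentiableZl; exact: differentiable_coord.
Qed.

Lemma jacobian_hemisphere b y i j : oball d y ->
  jacobian (@hemisphere R d b) y i j =
  if unlift ord0 j is Some k then (i == k)%:R else - (-1) ^+ b * y ord0 i / height y.
Proof.
move=> yB; have dh := differentiable_hemisphere b yB.
rewrite mxE -deriveE// derive_mx ?mxE; last exact: diff_derivable.
case: unliftP => [k ->|->].
  rewrite (_ : (fun _ => _) = fun z : 'rV[R]_d => z ord0 k).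
    by have [_ ->] := is_derive_coord y (delta_mx ord0 i) k; rewrite mxE eqxx eq_sym.
  by apply/funext => z; rewrite rV_consS.
rewrite (_ : (fun _ => _) = ((-1) ^+ b \*: (@height R d))); last first.
  by apply/funext => z; rewrite rV_cons0.
have D := is_deriveZ ((-1) ^+ b) (is_derive_height (delta_mx ord0 i) yB).
have [_ ->] := D.
have -> : \sum_k (delta_mx ord0 i : 'rV[R]_d) ord0 k * y ord0 k = y ord0 i.
  rewrite (bigD1 i)//= mxE !eqxx mul1r big1 ?addr0// => k ki.
  by rewrite mxE (negbTE ki) mul0r.
by rewrite /GRing.scale/= mulrA mulrN mulNr.
Qed.

(** For the Jacobian, [J J^T = 1 + y^T y / height^2] is a rank-one perturbation of determinant
    [1 + |y|^2 / height^2 = 1 / height^2]; the conformal factor contributes [e^(2 d t Phi)] before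
    the square root. *)
Lemma sqrt_det_pullback (Phi : 'rV[R]_d.+1 -> R) t b y : oball d y ->
  Num.sqrt (\det (pullback_metric (conformal t Phi) b y)) =
  expR (d%:R * (t * Phi (hemisphere b y))) / height y.
Proof.
move=> yB; have h0 := height_gt0 yB.
rewrite /pullback_metric /conformal /euclidean -scalemxAr mulmx1 -scalemxAl detZ.
move: (jacobian _ _) (fun i j => jacobian_hemisphere b i j yB) => J JE.
have -> : J *m J^T = 1%:M + ((height y ^- 2) *: y^T) *m y.
  apply/matrixP => i k; rewrite [LHS]mxE big_ord_recl addrC [RHS]mxE; congr (_ + _).
    rewrite (bigD1 i)//= big1 => [|j ji]; rewrite [_^T _ _]mxE !JE !liftK.
      by rewrite addr0 eqxx mul1r mxE eq_sym.
    by rewrite eq_sym (negbTE ji) mul0r.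
  rewrite [_^T _ _]mxE !JE !unlift_none.
  have e2 : ((-1) ^+ b) ^+ 2 = 1 :> R by rewrite -exprM mulnC exprM sqrrN expr1n expr1n.
  have -> : - (-1) ^+ b * y ord0 i / height y * (- (-1) ^+ b * y ord0 k / height y) =
      ((-1) ^+ b) ^+ 2 * (height y ^- 2 * y ord0 i * y ord0 k).
    by move: ((-1) ^+ b) (y ord0 i) (y ord0 k) (height y) h0 => *; field; exact: lt0r_neq0.
  by rewrite e2 mul1r mxE big_ord1 !mxE.
rewrite det_1_plus_rank1 -scalemxAr mxE sqnorm_mulmx.
have -> : 1 + height y ^- 2 * sqnorm y = (height y)^-1 ^+ 2.
  have -> : sqnorm y = 1 - height y ^+ 2 by rewrite sqr_height// opprB addrC subrK.
  by move: (height y) h0 => h h0; field; exact: lt0r_neq0.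
set p := Phi _; have -> : 2 * t * p = t * p + t * p by ring.
rewrite expRD -expr2 -exprM mulnC exprM -exprMn sqrtr_sqr.
by rewrite -expRM_natl ger0_norm// mulr_ge0 ?expR_ge0// invr_ge0 ltW.
Qed.

End hemisphere_chart.

(** * Integrals over the ball and the sphere *)

Section continuous_near_ball.
Context {R : realType} {n : nat}.
Implicit Types (F G : 'rV[R]_n -> R).

(** Continuity on a neighbourhood gives at once bounds on the compact ball and Borel measurability
    on the open ball and in the charts. *)
Definition cont_cball F := exists U, [/\ open U, cball n `<=` U &
  forall x, U x -> {for x, continuous F}].

Lemma cont_cball_smooth F : smooth_cball F -> cont_cball F.
Proof.
move=> [U [oU BU sF]]; exists U; split => // x Ux.
exact: (smooth_on_continuous (s := [::]) sF).
Qed.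

Lemma cont_cball_cst a : cont_cball (fun=> a).
Proof. by exists setT; split => //; [exact: openT|move=> x _; exact: cst_continuous]. Qed.

Lemma cont_cball_lin F G a : cont_cball F -> cont_cball G ->
  cont_cball (fun x => F x + a * G x).
Proof.
move=> [U [oU BU cF]] [V [oV BV cG]]; exists (U `&` V); split; first exact: openI.
  by move=> x xB; split; [exact: BU|exact: BV].
move=> x [/cF cFx /cG cGx].
by apply: (@cvgD _ _ _ (nbhs x)) => //; exact: cvgMl_tmp.
Qed.

Lemma cont_cball_comp (h : R -> R) F : continuous h -> cont_cball F ->
  cont_cball (fun x => h (F x)).
Proof.
move=> ch [U [oU BU cF]]; exists U; split => // x Ux.
by apply: (@continuous_comp _ _ _ F h); [exact: cF|exact: ch].
Qed.

Lemma cont_cball_exp F a b : cont_cball F -> cont_cball (fun x => expR (a * (b * F x))).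
Proof.
move=> cF; apply: (cont_cball_comp (h := fun r => expR (a * (b * r)))) => // r.
apply: (@continuous_comp _ _ _ (fun r => a * (b * r)) expR); last exact: continuous_expR.
by apply: cvgMl_tmp; apply: cvgMl_tmp.
Qed.

Lemma cont_cball_bound F : cont_cball F ->
  exists2 M : R, 0 < M & forall x, cball n x -> `|F x| <= M.
Proof.
move=> [U [_ BU cF]]; apply: compact_norm_bound; first exact: compact_cball.
by move=> x /BU; exact: cF.
Qed.

Lemma measurable_cont_oball F : cont_cball F -> measurable_fun (oball n) F.
Proof.
move=> [U [oU BU cF]]; apply: (@measurable_funS _ _ _ _ U).
- exact: open_measurable_rV.
- by move=> x /oball_cball; exact: BU.
- exact: continuous_measurable_rV.
Qed.

Lemma bounded_integrable_oball (f : 'rV[R]_n -> R) M :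
  measurable_fun (oball n) f -> (forall x, oball n x -> `|f x| <= M) ->
  (lebesgue_rV R n).-integrable (oball n) (EFin \o f).
Proof.
move=> mf bf; apply: measurable_bounded_integrable => //.
- exact: measurable_oball.
- exact: lebesgue_oball_lty.
- exists M; split; rewrite ?num_real// => r Mr x xB /=.
  exact: le_trans (bf x xB) (ltW Mr).
Qed.

Lemma integrable_cont_oball F : cont_cball F ->
  (lebesgue_rV R n).-integrable (oball n) (EFin \o F).
Proof.
move=> cF; have [M _ FM] := cont_cball_bound cF.
apply: (@bounded_integrable_oball _ M); first exact: measurable_cont_oball.
by move=> x /oball_cball; exact: FM.
Qed.

End continuous_near_ball.

Section integrals.
Context {R : realType} {d : nat}.
Implicit Types (F G Phi : 'rV[R]_d.+1 -> R).

Lemma measurable_cont_hemisphere F b : cont_cball F ->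
  measurable_fun (oball d) (fun y => F (hemisphere b y)).
Proof.
move=> [U [oU BU cF]].
apply: (@measurable_comp _ _ _ _ _ _ U F (oball d) (@hemisphere R d b)).
- exact: open_measurable_rV.
- by move=> _ [y yB <-]; apply: BU; apply: sphere_cball; exact: hemisphere_sphere.
- exact: continuous_measurable_rV.
- exact: measurable_funTS (measurable_hemisphere b).
Qed.

Lemma integrable_hemisphere F b : cont_cball F ->
  (lebesgue_rV R d).-integrable (oball d) (EFin \o (fun y => F (hemisphere b y))).
Proof.
move=> cF; have [M _ FM] := cont_cball_bound cF.
apply: (@bounded_integrable_oball _ _ _ M); first exact: measurable_cont_hemisphere.
by move=> y yB; apply: FM; apply: sphere_cball; exact: hemisphere_sphere.
Qed.

Lemma integrable_height_hemisphere F b : cont_cball F ->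
  (lebesgue_rV R d).-integrable (oball d)
    (EFin \o (fun y => height y * F (hemisphere b y))).
Proof.
move=> cF; have [M _ FM] := cont_cball_bound cF.
apply: (@bounded_integrable_oball _ _ _ M).
  apply: measurable_funM; last exact: measurable_cont_hemisphere.
  exact: measurable_funTS (@measurable_height R d).
move=> y yB; rewrite normrM -[leRHS]mul1r ler_pM//.
  by rewrite ger0_norm ?height_ge0// height_le1.
by apply: FM; apply: sphere_cball; exact: hemisphere_sphere.
Qed.

Definition ball_int F : R := \int[lebesgue_rV R d.+1]_(x in oball d.+1) F x.

(* The integral of [x_1^2 F] over the sphere: in the graph charts the factor
   [x_1^2 = height^2] absorbs the singular density [1 / height]. *)
Definition sphere_int F : R :=
  \sum_(b : bool) \int[lebesgue_rV R d]_(y in oball d) (height y * F (hemisphere b y)).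

Lemma ball_int_lin F G a : cont_cball F -> cont_cball G ->
  ball_int (fun x => F x + a * G x) = ball_int F + a * ball_int G.
Proof.
move=> cF cG; have mB := @measurable_oball R d.+1.
have iG := integrable_cont_oball cG.
rewrite /ball_int RintegralD//; first by rewrite RintegralZl.
- exact: integrable_cont_oball.
- apply: (@integrable_cont_oball _ _ (fun x => a * G x)).
  by apply: (cont_cball_comp (h := fun r => a * r)) => // r; exact: cvgMl_tmp.
Qed.

Lemma ball_int_le F G : cont_cball F -> cont_cball G ->
  (forall x, cball d.+1 x -> F x <= G x) -> ball_int F <= ball_int G.
Proof.
move=> cF cG FG; apply: le_Rintegral.
- exact: measurable_oball.
- exact: integrable_cont_oball.
- exact: integrable_cont_oball.
- by move=> x /oball_cball; exact: FG.
Qed.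

Lemma ball_int_cst a : ball_int (fun=> a) = a * ball_volume R d.
Proof. by rewrite /ball_int Rintegral_cst//; exact: measurable_oball. Qed.

Lemma sphere_int_lin F G a : cont_cball F -> cont_cball G ->
  sphere_int (fun x => F x + a * G x) = sphere_int F + a * sphere_int G.
Proof.
move=> cF cG; have mB := @measurable_oball R d.
rewrite /sphere_int mulr_sumr -big_split/=; apply: eq_bigr => b _.
rewrite -RintegralZl//; last exact: integrable_height_hemisphere.
rewrite -RintegralD//.
- by apply: eq_Rintegral => y _; rewrite mulrDr mulrCA.
- exact: integrable_height_hemisphere.
- rewrite (_ : _ \o _ = EFin \o (fun y => height y * (fun x => a * G x) (hemisphere b y))).
    apply: (@integrable_height_hemisphere (fun x => a * G x) b).
    by apply: (cont_cball_comp (h := fun r => a * r)) => // r; exact: cvgMl_tmp.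
  by apply/funext => y /=; rewrite mulrCA.
Qed.

Lemma sphere_int_le F G : cont_cball F -> cont_cball G ->
  (forall x, cball d.+1 x -> F x <= G x) -> sphere_int F <= sphere_int G.
Proof.
move=> cF cG FG; apply: ler_sum => b _; apply: le_Rintegral.
- exact: measurable_oball.
- exact: integrable_height_hemisphere.
- exact: integrable_height_hemisphere.
- move=> y yB; rewrite ler_wpM2l ?height_ge0// FG//.
  by apply: sphere_cball; exact: hemisphere_sphere.
Qed.

Lemma ball_volumeE : ball_volume R d =
  2 * \int[lebesgue_rV R d]_(y in oball d) height y.
Proof.
rewrite /ball_volume lebesgue_oballS -[LHS]/(\int[lebesgue_rV R d]_(y in oball d) (2 * height y)).
rewrite RintegralZl//; first exact: measurable_oball.
apply: (@bounded_integrable_oball _ _ _ 1).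
  exact: measurable_funTS (@measurable_height R d).
by move=> y _; rewrite ger0_norm ?height_ge0// height_le1.
Qed.

(** In the charts [x_1^2 dS = height dy]; the two hemispheres together give the integral of the
    chord length [2 height], which is the volume. *)
Lemma sphere_int_cst a : sphere_int (fun=> a) = a * ball_volume R d.
Proof.
have -> : a * ball_volume R d = \sum_(b : bool)
    a * \int[lebesgue_rV R d]_(y in oball d) height y.
  by rewrite big_bool/= ball_volumeE; ring.
apply: eq_bigr => b _; rewrite mulrC -RintegralZr//; first exact: measurable_oball.
apply: (@bounded_integrable_oball _ _ _ 1).
  exact: measurable_funTS (@measurable_height R d).
by move=> y _; rewrite ger0_norm ?height_ge0// height_le1.
Qed.

Lemma sqrt_det_conformal n t (Phi : 'rV[R]_n -> R) x :
  Num.sqrt (\det (conformal t Phi x)) = expR (n%:R * (t * Phi x)).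
Proof.
rewrite /conformal /euclidean detZ det1 mulr1.
have -> : 2 * t * Phi x = t * Phi x + t * Phi x by ring.
rewrite expRD -expr2 -exprM mulnC exprM sqrtr_sqr ger0_norm ?exprn_ge0 ?expR_ge0//.
by rewrite expRM_natl.
Qed.

Lemma vol_integral_conformal t Phi F :
  vol_integral (conformal t Phi) F =
  (\int[lebesgue_rV R d.+1]_(x in oball d.+1) (F x * expR (d.+1%:R * (t * Phi x)))%:E)%E.
Proof. by apply: eq_integral => x _; rewrite sqrt_det_conformal. Qed.

Lemma surf_integral_conformal t Phi F :
  surf_integral (conformal t Phi) F =
  (\sum_(b : bool) \int[lebesgue_rV R d]_(y in oball d)
    (F (hemisphere b y) * (expR (d%:R * (t * Phi (hemisphere b y))) / height y))%:E)%E.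
Proof.
apply: eq_bigr => b _; apply: eq_integral => y /set_mem yB.
by rewrite sqrt_det_pullback.
Qed.

(** The case [t = 0] of the conformal integral formulas then evaluates [L_functional]. *)
Lemma euclidean_conformal n (Phi : 'rV[R]_n -> R) :
  @euclidean R n = conformal 0 Phi.
Proof. by apply/funext => x; rewrite /conformal mulr0 mul0r expR0 scale1r. Qed.

Lemma EFin_Rintegral_oball n (f : 'rV[R]_n -> R) :
  (lebesgue_rV R n).-integrable (oball n) (EFin \o f) ->
  (\int[lebesgue_rV R n]_(x in oball n) (f x)%:E)%E =
  (\int[lebesgue_rV R n]_(x in oball n) f x)%:E.
Proof.
by move=> fi; rewrite /Rintegral fineK//; apply: integrable_fin_num => //; exact: measurable_oball.
Qed.

Lemma surf_integral_sqr t Phi F (H := fun x => F x * expR (d%:R * (t * Phi x))) :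
  cont_cball H ->
  surf_integral (conformal t Phi) (fun x => x ord0 ord0 ^+ 2 * F x) = (sphere_int H)%:E.
Proof.
move=> cH; rewrite surf_integral_conformal /sphere_int -sumEFin; apply: eq_bigr => b _.
rewrite -EFin_Rintegral_oball; last exact: integrable_height_hemisphere.
apply: eq_integral => y /set_mem yB; congr EFin.
rewrite {1}/hemisphere rV_cons0 exprMn -exprM mulnC exprM sqrrN expr1n expr1n mul1r.
rewrite -/(height y) /H; have := height_gt0 yB.
by move: (F _) (expR _) (height y) => a e h h0; field; exact: lt0r_neq0.
Qed.

Lemma L_functionalE F : cont_cball F ->
  L_functional F = (ball_volume R d)^-1 *
    ((d.+1%:R - 2) * ball_int F - (d.+1%:R - 1) * sphere_int F).
Proof.
move=> cF; rewrite /L_functional (euclidean_conformal F) vol_integral_conformal.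
have E (a : R) x : F x * expR (a * (0 * F x)) = F x by rewrite mul0r mulr0 expR0 mulr1.
rewrite surf_integral_sqr; last by under eq_fun do rewrite E.
under eq_integral do rewrite E.
by congr (_ * (_ - _ * _)); rewrite /= (funext (E d%:R)).
Qed.

End integrals.

(** * The Rayleigh quotient of x_1 *)

Section first_coordinate.
Context {R : realType} {d : nat}.
Implicit Types (q : {poly R}) (x : 'rV[R]_d.+1).

(** A class closed under partial derivatives; it contains the test function [x_1] and the even
    powers used as perturbations. *)
Definition poly_x1 q x : R := q.[x ord0 ord0].

Lemma differentiable_poly_x1 q x : differentiable (poly_x1 q) x.
Proof.
apply: (differentiable_comp (differentiable_coord x ord0 ord0) (g := horner q)).
by apply/derivable1_diffP; exact: derivable_horner.
Qed.

Lemma partial_poly_x1 q i :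
  partial i (poly_x1 q) = poly_x1 (if i == ord0 then q^`() else 0).
Proof.
apply/funext => x; rewrite /partial.
have dq : is_derive (x ord0 ord0) 1 (horner q) (q^`().[x ord0 ord0]).
  apply: DeriveDef; first exact: derivable_horner.
  by rewrite -derive1E -derivE.
have [_ ->] := is_derive_comp (delta_mx ord0 i) (differentiable_coord x ord0 ord0) dq.
have [_ ->] := is_derive_coord x (delta_mx ord0 i) ord0.
rewrite mxE eqxx /= eq_sym /poly_x1; case: eqP => _; first by rewrite mulr1.
by rewrite mulr0 horner0.
Qed.

Lemma partials_poly_x1 s q : exists q', partials s (poly_x1 q) = poly_x1 q'.
Proof.
elim: s => [|i s [q' E]]; first by exists q.
by exists (if i == ord0 then q'^`() else 0); rewrite /= E partial_poly_x1.
Qed.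

Lemma smooth_on_poly_x1 U q : smooth_on U (poly_x1 q).
Proof.
move=> s x _; have [q' ->] := partials_poly_x1 s q.
exact: differentiable_poly_x1.
Qed.

Lemma smooth_cball_poly_x1 q : smooth_cball (poly_x1 q).
Proof. by exists setT; split => //; [exact: openT|exact: smooth_on_poly_x1]. Qed.

Lemma poly_x1X : poly_x1 'X = fun x => x ord0 ord0.
Proof. by apply/funext => x; rewrite /poly_x1 hornerX. Qed.

Lemma differential_x1 x :
  differential (fun x : 'rV[R]_d.+1 => x ord0 ord0) x = delta_mx ord0 ord0.
Proof.
apply/rowP => i; rewrite [LHS]mxE -poly_x1X partial_poly_x1 mxE eqxx /poly_x1.
by case: eqP => _; rewrite ?derivX ?hornerC ?horner0.
Qed.

End first_coordinate.

Section steklov.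
Context {R : realType} {d : nat}.
Implicit Types (F G Phi : 'rV[R]_d.+1 -> R).
Let x1 (x : 'rV[R]_d.+1) : R := x ord0 ord0.

Lemma reflect1_hemisphere b (y : 'rV[R]_d) :
  reflect1 (hemisphere b y) = hemisphere (~~ b) y.
Proof.
apply/rowP => i; rewrite mxE; have [k ->|->] := unliftP ord0 i.
  by rewrite /= /hemisphere !rV_consS.
by rewrite eqxx /hemisphere !rV_cons0; case: b; rewrite ?expr0 ?expr1 ?mulN1r ?mul1r ?opprK.
Qed.

(** In the charts [x_1 / height = +- 1], so the hemispheres contribute the integrals of the
    conformal density with opposite signs; evenness makes the two densities equal. *)
Lemma surf_integral_x1 t Phi : even_smooth Phi ->
  surf_integral (conformal t Phi) x1 = 0%E.
Proof.
move=> [sP eP]; have cP := cont_cball_smooth sP.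
pose G b y := expR (d%:R * (t * Phi (hemisphere b y))).
have Gi b : (lebesgue_rV R d).-integrable (oball d) (EFin \o G b).
  by apply: (@integrable_hemisphere R d (fun x => expR (d%:R * (t * Phi x)))); exact: cont_cball_exp.
have GE y : oball d y -> G true y = G false y.
  move=> yB; rewrite /G -(eP (hemisphere false y)) ?reflect1_hemisphere//.
  by apply: sphere_cball; exact: hemisphere_sphere.
rewrite surf_integral_conformal big_bool/=.
have I1 : (\int[lebesgue_rV R d]_(y in oball d) (x1 (hemisphere true y) *
    (expR (d%:R * (t * Phi (hemisphere true y))) / height y))%:E)%E =
    (- \int[lebesgue_rV R d]_(y in oball d) G false y)%:E.
  rewrite -mulN1r -RintegralZl//; last exact: measurable_oball.
  rewrite -EFin_Rintegral_oball; last first.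
    rewrite (_ : _ \o _ = (fun y => (-1)%:E * (EFin \o G false) y)%E).
      by apply: integrableZl => //; exact: measurable_oball.
    by apply/funext => y /=; rewrite EFinM.
  apply: eq_integral => y /set_mem yB; congr EFin.
  rewrite -(GE _ yB) /x1 {1}/hemisphere rV_cons0 -/(height y) expr1 -/(G true y).
  have := height_gt0 yB.
  by move: (G _ _) (height y) => a h h0; field; exact: lt0r_neq0.
have I2 : (\int[lebesgue_rV R d]_(y in oball d) (x1 (hemisphere false y) *
    (expR (d%:R * (t * Phi (hemisphere false y))) / height y))%:E)%E =
    (\int[lebesgue_rV R d]_(y in oball d) G false y)%:E.
  rewrite -EFin_Rintegral_oball//; apply: eq_integral => y /set_mem yB; congr EFin.
  rewrite /x1 {1}/hemisphere rV_cons0 -/(height y) expr0 mul1r -/(G false y).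
  have := height_gt0 yB.
  by move: (G _ _) (height y) => a h h0; field; exact: lt0r_neq0.
by rewrite I1 I2 -EFinD addNr.
Qed.

(** If the integral vanished, the integrand would vanish almost everywhere, and the ball would lie
    in the null hyperplane [x_1 = 0] up to a null set. *)
Lemma vol_integral_x1_neq0 t Phi : smooth_cball Phi -> 0 < ball_volume R d ->
  vol_integral (conformal t Phi) (fun x => x1 x ^+ 2) != 0%E.
Proof.
move=> sP vol0; rewrite vol_integral_conformal.
set f := fun x : 'rV[R]_d.+1 => _; apply/eqP => f0.
have mf : measurable_fun (oball d.+1) f.
  apply/measurable_EFinP; apply: measurable_funM.
    by apply: measurable_funX; apply: measurable_funTS; exact: measurable_coord.
  apply: measurable_cont_oball; apply: cont_cball_exp.
  exact: cont_cball_smooth.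
have : (\int[lebesgue_rV R d.+1]_(x in oball d.+1) `|f x|)%E = 0%E.
  rewrite -[RHS]f0; apply: eq_integral => x _; rewrite gee0_abs// lee_fin.
  by rewrite mulr_ge0 ?sqr_ge0 ?expR_ge0.
move/(ae_eq_integral_abs (lebesgue_rV R d.+1) (@measurable_oball R d.+1) mf).
move=> [A [mA A0 fA]].
suff : (lebesgue_rV R d.+1 (oball d.+1) <= 0)%E.
  move=> vle; move: vol0; rewrite /ball_volume.
  by have /eqP -> : lebesgue_rV R d.+1 (oball d.+1) == 0%E; rewrite ?ltxx// eq_le vle measure_ge0.
have mH : measurable [set x : 'rV[R]_d.+1 | x ord0 ord0 = 0].
  by rewrite -[X in measurable X]setTI; exact: (@measurable_coord R d.+1 ord0 measurableT [set 0]).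
set Z := [set x : 'rV[R]_d.+1 | x ord0 ord0 = 0] in mH.
have le1 : (lebesgue_rV R d.+1 (oball d.+1) <= lebesgue_rV R d.+1 (Z `|` A))%E.
  apply: le_measure; rewrite ?inE; [exact: measurable_oball|exact: measurableU|].
  move=> x xB; have [x0|x0] := eqVneq (x ord0 ord0) 0; first by left.
  right; apply: fA => /= /(_ xB) /eqP.
  by rewrite /f eqe mulf_eq0 expf_eq0 /= /x1 (negbTE x0)/= gt_eqF ?expR_gt0.
have le2 : (lebesgue_rV R d.+1 (Z `|` A) <= lebesgue_rV R d.+1 Z + lebesgue_rV R d.+1 A)%E.
  exact: measureU2.
have Z0 : lebesgue_rV R d.+1 Z = 0%E by exact: lebesgue_hyperplane.
rewrite Z0 A0 adde0 in le2; exact: le_trans le1 le2.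
Qed.

(** [x_1] is already smooth, so the constant sequence approximates it. *)
Lemma H1_x1 t Phi : H1_with_trace (conformal t Phi) x1 (fun=> delta_mx ord0 ord0) x1.
Proof.
have mx1 : measurable_fun setT x1 by exact: measurable_coord.
split; [exact: measurable_funTS|exact: measurable_cst|exact: measurable_funTS|].
exists (fun=> x1); split => [k|||].
- by rewrite -[x1](@poly_x1X R d); exact: smooth_cball_poly_x1.
- have -> : vol_integral (conformal t Phi) (fun x => (x1 x - x1 x) ^+ 2) = 0%E.
    by apply: integral0_eq => x _; rewrite subrr expr0n mul0r.
  exact: cvg_cst.
- have -> : vol_integral (conformal t Phi) (fun x => cosqnorm (conformal t Phi) x
      (differential x1 x - delta_mx ord0 ord0)) = 0%E.
    apply: integral0_eq => x _; rewrite differential_x1 subrr /cosqnorm.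
    by rewrite !mul0mx mxE mul0r.
  exact: cvg_cst.
- have -> : surf_integral (conformal t Phi) (fun x => (x1 x - x1 x) ^+ 2) = 0%E.
    rewrite /surf_integral big1// => b _.
    by apply: integral0_eq => x _; rewrite subrr expr0n mul0r.
  exact: cvg_cst.
Qed.

Lemma cosqnorm_x1 t Phi x :
  cosqnorm (conformal t Phi) x (delta_mx ord0 ord0 : 'rV[R]_d.+1) =
  expR (- (2 * (t * Phi x))).
Proof.
rewrite /cosqnorm invmx_conformal -scalemxAr mulmx1 -scalemxAl mxE sqnorm_mulmx.
rewrite expRN mulrA [sqnorm _](_ : _ = 1) ?mulr1//.
rewrite /sqnorm big_ord_recl mxE eqxx expr1n big1 ?addr0// => i _.
by rewrite mxE /= expr0n.
Qed.

(** Tests the infimum with [x_1]. The exponent [n - 2] of the numerator is [n] from the volume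
    density minus 2 from the inverse metric in [|dx_1|^2]. *)
Lemma steklov1_le t Phi : even_smooth Phi -> 0 < ball_volume R d ->
  let N := ball_int (fun x => expR ((d.+1%:R - 2) * (t * Phi x))) in
  let D := sphere_int (fun x => expR (d%:R * (t * Phi x))) in
  0 < D -> (steklov1 (conformal t Phi) <= (N / D)%:E)%E.
Proof.
move=> eP vol0 N D D0; have cP := cont_cball_smooth eP.1.
apply: ereal_inf_lbound; exists x1, (fun=> delta_mx ord0 ord0), x1; split.
- exact: H1_x1.
- by apply: vol_integral_x1_neq0 => //; exact: eP.1.
- exact: surf_integral_x1.
have -> : vol_integral (conformal t Phi)
    (fun x => cosqnorm (conformal t Phi) x (delta_mx ord0 ord0)) = N%:E.
  rewrite vol_integral_conformal /N /ball_int -EFin_Rintegral_oball; last first.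
    by apply: integrable_cont_oball; exact: cont_cball_exp.
  apply: eq_integral => x _; rewrite cosqnorm_x1 -expRD; congr (expR _)%:E.
  by rewrite -natr1; ring.
have -> : surf_integral (conformal t Phi) (fun x => x1 x ^+ 2) = D%:E.
  have := @surf_integral_sqr R d t Phi (fun=> 1).
  under [X in surf_integral _ X]eq_fun do rewrite mulr1.
  move=> ->; first by rewrite /D; congr ((sphere_int _)%:E); apply/funext => x; rewrite mul1r.
  by under eq_fun do rewrite mul1r; exact: cont_cball_exp.
by rewrite inver gt_eqF// EFinM.
Qed.

(** With zero volume the convention [0^-1 = 0] would make [L_functional F] vanish. *)
Lemma ball_volume_gt0 F : L_functional F < 0 -> 0 < ball_volume R d.
Proof.
move=> L0; rewrite lt_def fine_ge0 ?measure_ge0// andbT; apply/eqP => w0.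
by move: L0; rewrite /L_functional w0 invr0 mul0r ltxx.
Qed.

Lemma steklov_small Phi : (1 <= d)%N -> even_smooth Phi -> L_functional Phi < 0 ->
  exists2 t0 : R, 0 < t0 & forall t, 0 < t < t0 ->
    (steklov1 (conformal t Phi) < 1)%E.
Proof.
move=> d1 eP L0; have cP := cont_cball_smooth eP.1; have w0 := ball_volume_gt0 L0.
move: L0; rewrite L_functionalE//; set w := ball_volume R d in w0 *.
set V := ball_int Phi; set S := sphere_int Phi => L0.
have [M M0 PM] := cont_cball_bound cP.
pose m : R := d.+1%:R - 2; have m0 : 0 <= m by rewrite subr_ge0 ler_nat.
have dE : d.+1%:R - 1 = d%:R :> R by rewrite -natr1 addrK.
(* [k] is the volume times [- L_functional Phi], the first-order gain of denominator over
   numerator. *)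
pose k := d%:R * S - m * V.
have k0 : 0 < k.
  by move: L0; rewrite pmulr_rlt0 ?invr_gt0// dE subr_lt0 -subr_gt0.
(* [t c < 1] yields [t m M <= 1/2], so that the quadratic bound applies to the numerator, and
   [2 t (m M)^2 w < k], so that its error stays below the gain. The added 1 keeps [c] positive when
   [m = 0]. *)
pose c := 2 * (m * M) + 2 * (m * M) ^+ 2 * w / k + 1.
have c2 : 0 <= 2 * (m * M) ^+ 2 * w / k.
  apply: divr_ge0; last exact: ltW.
  apply: mulr_ge0; last exact: ltW.
  by apply: mulr_ge0 => //; exact: sqr_ge0.
have mM : 0 <= m * M by rewrite mulr_ge0// ltW.
have c0 : 0 < c by rewrite /c ltr_wpDl// addr_ge0// mulr_ge0.
exists c^-1; first by rewrite invr_gt0.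
move=> t /andP[t0]; rewrite -[ltRHS]div1r ltr_pdivlMr// => tc.
have tM : t * (m * M) <= 2^-1.
  have : t * (2 * (m * M)) <= t * c by rewrite ler_pM2l// /c -addrA lerDl addr_ge0.
  lra.
have tk : t * (2 * (m * M) ^+ 2 * w) < k.
  rewrite -[ltRHS]mul1r -ltr_pdivrMr//; apply: le_lt_trans tc.
  have -> : t * (2 * (m * M) ^+ 2 * w) / k = t * (2 * (m * M) ^+ 2 * w / k) by rewrite [RHS]mulrA.
  apply: ler_wpM2l; first exact: ltW.
  by rewrite /c addrAC lerDr addr_ge0// mulr_ge0.
have c1 := @cont_cball_cst R d.+1.
set N := ball_int (fun x => expR (m * (t * Phi x))).
set D := sphere_int (fun x => expR (d%:R * (t * Phi x))).
have NE : N <= w + m * t * V + 2 * (m * t * M) ^+ 2 * w.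
  have -> : w + m * t * V + 2 * (m * t * M) ^+ 2 * w =
      ball_int (fun x => (1 + 2 * (m * t * M) ^+ 2) + m * t * Phi x).
    by rewrite ball_int_lin// ball_int_cst -/w -/V; ring.
  apply: ball_int_le; [exact: cont_cball_exp|exact: cont_cball_lin|].
  move=> x /PM Mx.
  have z2 : `|m * (t * Phi x)| <= m * t * M.
    by rewrite mulrA normrM ger0_norm ?ler_wpM2l// mulr_ge0// ltW.
  apply: le_trans (expR_le_quadratic _) _.
    apply: le_trans z2 _; have -> : m * t * M = t * (m * M) by ring.
    exact: tM.
  have : (m * (t * Phi x)) ^+ 2 <= (m * t * M) ^+ 2.
    rewrite -real_normK ?num_real// ler_pXn2r// nnegrE.
    by rewrite !mulr_ge0// ltW.
  by rewrite mulrA; lra.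
have DE : w + d%:R * t * S <= D.
  have -> : w + d%:R * t * S = sphere_int (fun x => 1 + d%:R * t * Phi x).
    by rewrite sphere_int_lin// sphere_int_cst -/w -/S; ring.
  apply: sphere_int_le; [exact: cont_cball_lin|exact: cont_cball_exp|].
  by move=> x _; rewrite -mulrA expR_ge1Dx.
have ND : N < D.
  apply: le_lt_trans NE _; apply: lt_le_trans DE.
  have : t * (t * (2 * (m * M) ^+ 2 * w)) < t * k by rewrite ltr_pM2l.
  rewrite /k; clearbody m w V S; move: (d%:R : R) => e; nra.
have N0 : 0 <= N by apply: Rintegral_ge0 => x _; exact: expR_ge0.
have D0 : 0 < D by exact: le_lt_trans ND.
have Sle : (steklov1 (conformal t Phi) <= (N / D)%:E)%E by exact: steklov1_le.
apply: le_lt_trans Sle _.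
by rewrite lte_fin ltr_pdivrMr// mul1r.
Qed.

End steklov.

(** * Openness and infinite dimension *)

Section openness.
Context {R : realType} {d : nat}.
Hypothesis d2 : (2 <= d)%N.
Implicit Types (f h Phi : 'rV[R]_d.+1 -> R).

Lemma L_functional_neg_open f : smooth_cball f -> L_functional f < 0 ->
  exists2 e : R, 0 < e & forall h, smooth_cball h -> C2_close e f h ->
    L_functional h < 0.
Proof.
move=> sf L0; have w0 := ball_volume_gt0 L0; have cf := cont_cball_smooth sf.
move: L0; rewrite L_functionalE// pmulr_rlt0 ?invr_gt0//.
set w := ball_volume R d in w0 *; set V := ball_int f; set S := sphere_int f.
have dE : d.+1%:R - 1 = d%:R :> R by rewrite -natr1 addrK.
pose m : R := d.+1%:R - 2; have m0 : 0 <= m by rewrite subr_ge0 ler_nat ltnS ltnW.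
rewrite dE -/m => L0; pose k := d%:R * S - m * V.
have k0 : 0 < k by move: L0; rewrite subr_lt0 -subr_gt0.
have dm : 0 < (m + d%:R + 1) * w by rewrite mulr_gt0// ltr_wpDl// addr_ge0.
(* A uniform change of size [e] moves the ball and sphere integrals by at most [e w] each, hence
   [m V - d S] by at most [(m + d) e w]; the extra 1 gives strictness. *)
exists (k / ((m + d%:R + 1) * w)); first by rewrite divr_gt0.
set e := k / _; have ek : (m + d%:R + 1) * w * e = k by rewrite /e mulrCA divff ?mulr1// gt_eqF.
have e0 : 0 < e by rewrite divr_gt0.
move=> h sh ch; have cch := cont_cball_smooth sh.
rewrite L_functionalE// pmulr_rlt0 ?invr_gt0// dE -/m.
have hf x : cball d.+1 x -> h x <= e + 1 * f x /\ f x <= e + 1 * h x.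
  by move=> xB; have := ch [::] x isT xB; rewrite /= ler_norml => /andP[*]; split; lra.
have cst_e := @cont_cball_cst R d.+1 e.
have hV : ball_int h <= e * w + V.
  have := ball_int_le cch (cont_cball_lin 1 cst_e cf) (fun x xB => (hf x xB).1).
  by rewrite ball_int_lin// ball_int_cst mul1r.
have hS : S <= e * w + sphere_int h.
  have := sphere_int_le cf (cont_cball_lin 1 cst_e cch) (fun x xB => (hf x xB).2).
  by rewrite sphere_int_lin// sphere_int_cst mul1r.
have h1 : m * ball_int h <= m * (e * w + V) by rewrite ler_wpM2l.
have h2 : d%:R * S <= d%:R * (e * w + sphere_int h) by rewrite ler_wpM2l.
have ew : 0 < e * w by rewrite mulr_gt0.
move: h1 h2 ek ew; rewrite /k.
move: (ball_int h) (sphere_int h) (d%:R : R) => B C D; clearbody m w V S e.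
by move=> *; nra.
Qed.

Lemma admissible_open f : admissible f ->
  exists2 e : R, 0 < e & forall h, even_smooth h -> C2_close e f h -> admissible h.
Proof.
move=> [[sf ef] Af qf Lf].
have [e1 e10 h1] := A_tensor_posdef_open sf Af.
have [e2 e20 h2] := q_bdry_pos_open sf qf.
have [e3 e30 h3] := L_functional_neg_open sf Lf.
exists (Num.min e1 (Num.min e2 e3)); first by rewrite !lt_min e10 e20.
move=> h eh ch; have sh := eh.1.
have ch1 : C2_close e1 f h by apply: C2_closeW ch; rewrite ge_min lexx.
have ch2 : C2_close e2 f h by apply: C2_closeW ch; rewrite !ge_min lexx orbT.
have ch3 : C2_close e3 f h by apply: C2_closeW ch; rewrite !ge_min lexx !orbT.
split; [exact: eh|exact: (h1 h ch1)|exact: (h2 h sh ch2)|exact: (h3 h sh ch3)].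
Qed.

Lemma admissible_C2_open : C2_open_in (@even_smooth R d) (@admissible R d).
Proof.
split => [f []//|f af]; have [e e0 he] := admissible_open af.
have sf := (let: And4 ef _ _ _ := af in ef).1.
by exists e => // h eh hf; apply: he => //; apply: C2_close_norm hf => //; exact: eh.1.
Qed.

Lemma admissible_small_time f : admissible f -> small_steklov_for_small_time f.
Proof.
move=> [ef Af qf Lf]; have d1 : (1 <= d)%N := ltnW d2.
have [t1 t10 h1] := ricci_positive_small (leqW d2) ef.1 Af.
have [t2 t20 h2] := second_form_gt_small ef.1 qf.
have [t3 t30 h3] := steklov_small d1 ef Lf.
exists (Num.min t1 (Num.min t2 t3)); first by rewrite !lt_min t10 t20.
move=> t /andP[t0]; rewrite !lt_min => /and3P[a b c].
by split; [apply: h1|apply: h2|apply: h3]; rewrite t0.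
Qed.

(** Up to order 2 the partials are among [q], [q'], [q''] at [x_1], or zero, so one constant serves
    all multi-indices. *)
Lemma partials_poly_x1_bound (q : {poly R}) : exists2 M : R, 0 < M &
  forall s (x : 'rV[R]_d.+1), (size s <= 2)%N -> cball d.+1 x ->
    `|partials s (poly_x1 q) x| <= M.
Proof.
have bd q' : exists2 M : R, 0 < M &
    forall x : 'rV[R]_d.+1, cball d.+1 x -> `|poly_x1 q' x| <= M.
  exact: (partials_bound [::] (smooth_cball_poly_x1 q')).
have [M0 M00 h0] := bd q; have [M1 M10 h1] := bd q^`(); have [M2 M20 h2] := bd q^`()^`().
exists (M0 + M1 + M2); first by rewrite !addr_gt0.
have zero (x : 'rV[R]_d.+1) : poly_x1 0 x = 0 by rewrite /poly_x1 horner0.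
move=> [|i [|j [|? ?]]] x // _ xB; rewrite /= ?partial_poly_x1.
- by have := h0 x xB; lra.
- by case: ifP => _; [have := h1 x xB|rewrite zero normr0]; lra.
- case: ifP => _; last by rewrite zero normr0; lra.
  by case: ifP => _; [have := h2 x xB|rewrite deriv0 zero normr0]; lra.
Qed.

Lemma admissible_perturb f (q : {poly R}) : admissible f ->
  (forall r, q.[- r] = q.[r]) ->
  exists2 e : R, 0 < e & admissible (fun x => f x + e * poly_x1 q x).
Proof.
move=> af qe; have [r r0 rf] := admissible_open af.
have [[sf ef] _ _ _] := af.
have [M M0 hM] := partials_poly_x1_bound q.
have [U [oU BU {}sf]] := sf.
have sq := @smooth_on_poly_x1 R d U q.
exists (r / M); first by rewrite divr_gt0.
apply: rf.
  split; first by exists U; split => //; exact: smooth_on_lin.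
  by move=> x xB; rewrite ef// /poly_x1 mxE eqxx qe.
move=> s x s2 xB; rewrite (partials_lin (r / M) oU sf sq s (BU _ xB)).
move: (partials s f x) (partials s (poly_x1 q) x) (hM s x s2 xB) => a b bM.
by rewrite addrAC subrr add0r normrM gtr0_norm ?divr_gt0// mulrAC ler_pdivrMr// ler_pM2l.
Qed.

(** If [N] functions spanned the admissible ones, they would span the [N + 1] even powers of [x_1]
    from degree 0 to [2 N], which would then be linearly dependent on the ball; a polynomial
    vanishing on [0, 1] is zero. *)
Lemma admissible_infinite_dimensional f : admissible f ->
  infinite_dimensional (@admissible R d).
Proof.
move=> af N e; apply: contrapT => nospan.
have span g : admissible g -> exists c : 'I_N -> R,
    forall x, cball d.+1 x -> g x = \sum_i c i * e i x.
  move=> ag; apply: contrapT => nog; apply: nospan; exists g => // c.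
  apply: contrapT => noc; apply: nog; exists c => x xB.
  by apply: contrapT => gx; apply: noc; exists x.
(* Each even power is a multiple of the difference of two admissible functions, [f] and its
   perturbation. *)
have /choice[a aE] : forall k : 'I_N.+1, exists a : 'I_N -> R,
    forall x : 'rV[R]_d.+1, cball d.+1 x -> (x ord0 ord0) ^+ (2 * k) = \sum_i a i * e i x.
  move=> k; have [|r r0 ar] := @admissible_perturb f ('X^(2 * k)) af.
    by move=> r; rewrite !hornerXn !exprM sqrrN.
  have [c cE] := span _ af; have [c' c'E] := span _ ar.
  exists (fun i => r^-1 * (c' i - c i)) => x xB.
  have -> : \sum_i r^-1 * (c' i - c i) * e i x =
      r^-1 * (\sum_i c' i * e i x - \sum_i c i * e i x).
    by rewrite -sumrB mulr_sumr; apply: eq_bigr => i _; rewrite -mulrA mulrBl.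
  rewrite -c'E// -cE// addrAC subrr add0r mulrA mulVf ?gt_eqF// mul1r.
  by rewrite /poly_x1 hornerXn.
pose A := \matrix_(k < N.+1, i < N) a k i.
(* [N + 1] coefficient vectors in dimension [N] satisfy a nontrivial relation [u]. *)
have : kermx A != 0.
  rewrite kermx_eq0 /row_free neq_ltn; apply/orP; left.
  by rewrite ltnS rank_leq_col.
move=> /rowV0Pn[u /sub_kermxP uA] /eqP; apply.
pose P : {poly R} := \sum_(k < N.+1) u ord0 k *: 'X^(2 * k).
have P0 : P = 0.
  (* The points [1 / (j + 1)] for [j < size P] are distinct and lie in [0, 1], so each is the first
     coordinate of a point of the ball on the [x_1] axis, where the relation makes [P] vanish. *)
  apply: (@roots_geq_poly_eq0 _ _ [seq (j.+1%:R)^-1 : R | j <- iota 0 (size P)]).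
  - apply/allP => _ /mapP[j _ ->]; rewrite /root /P horner_sum.
    set r : R := _^-1; pose x : 'rV[R]_d.+1 := r *: delta_mx ord0 ord0.
    have xr : x ord0 ord0 = r by rewrite !mxE !eqxx mulr1.
    have r01 : 0 <= r <= 1 by rewrite invr_ge0 ler0n/= invf_le1 ?ltr0n// ler1n.
    have xB : cball d.+1 x.
      rewrite /cball/= /x sqnormZ -sqnorm_mulmx trmx_delta mul_delta_mx mxE eqxx mulr1.
      by have /andP[r0 r1] := r01; rewrite expr_le1.
    apply/eqP; transitivity (\sum_k u ord0 k * \sum_i a k i * e i x).
      by apply: eq_bigr => k _; rewrite hornerZ hornerXn -xr aE.
    transitivity (\sum_i (u *m A) ord0 i * e i x).
      rewrite (eq_bigr _ (fun k _ => mulr_sumr _ _ _ _)) exchange_big/=.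
      apply: eq_bigr => i _; rewrite mxE mulr_suml.
      by apply: eq_bigr => k _; rewrite mxE mulrA.
    by rewrite uA big1// => i _; rewrite mxE mul0r.
  - rewrite map_inj_uniq ?iota_uniq// => j1 j2 /invr_inj /eqP.
    by rewrite eqr_nat eqSS => /eqP.
  - by rewrite size_map size_iota.
apply/rowP => k; rewrite mxE; have := congr1 (fun p : {poly R} => p`_(2 * k)) P0.
rewrite coef0 /P coef_sum (bigD1 k)//= coefZ coefXn eqxx mulr1 big1 ?addr0//.
by move=> j jk; rewrite coefZ coefXn eqn_pmul2l// eq_sym (inj_eq val_inj) (negbTE jk) mulr0.
Qed.

End openness.

(* The dimension is n = d.+1. *)
Theorem theorem1p2 (R : realType) (d : nat) (hn : (3 <= d.+1)%N) :
  [/\ forall Phi : 'rV[R]_d.+1 -> R, admissible Phi ->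
        exists2 t0 : R, 0 < t0 & forall t : R, 0 < t < t0 ->
          [/\ ricci_positive (conformal t Phi),
              second_form_gt_metric (conformal t Phi) &
              (steklov1 (conformal t Phi) < 1)%E],
      C2_open_in (@even_smooth R d) (@admissible R d) &
      forall Phi : 'rV[R]_d.+1 -> R, admissible Phi ->
        exists U : set ('rV[R]_d.+1 -> R),
          [/\ U Phi, C2_open_in (@even_smooth R d) U, infinite_dimensional U &
              U `<=` small_steklov_for_small_time (d := d)]].
Proof.
have d2 : (2 <= d)%N := hn.
split; [by move=> Phi; exact: admissible_small_time|exact: admissible_C2_open|].
move=> Phi aPhi; exists (@admissible R d); split => //.
- exact: admissible_C2_open.
- exact: (admissible_infinite_dimensional d2 aPhi).
- by move=> f; exact: admissible_small_time.
Qed.
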